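(* Fix $c\in(0,1)$, let $S:=[-1,-c)\cup(c,1]$, define $h_1:=\chi_S$ and recursively for $n\ge2$ $$h_n(\gamma):=\int_{\mathbb{R}} h_{n-1}(t)\,\chi_S\Big(\frac{\gamma}{|t|}\Big)\,dt,\qquad\gamma\in\mathbb{R},$$ and let $Q_n:=\int_{\mathbb{R}}h_n(\gamma)\,d\gamma$. Let $n\ge2$ be an integer, fix $b\in(0,c^{n-1}/2]$, and define $\psi,\widetilde\psi\in L^2(\mathbb{R})$ by $\widehat\psi:=h_n$ and $$\widehat{\widetilde\psi}(\gamma):=\frac{b}{Q_{n-1}^2}\sum_{j=-n+1}^{n-1}h_n(c^j\gamma),\qquad\gamma\in\mathbb{R}.$$ Then $\{D_{c^j}T_{kb}\psi\}_{j,k\in\mathbb{Z}}$ and $\{D_{c^j}T_{kb}\widetilde\psi\}_{j,k\in\mathbb{Z}}$ are dual wavelet frames for $L^2(\mathbb{R})$.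
   Context: $\chi_S$ is the indicator function of $S$. The Fourier transform is $\widehat f(\gamma)=\int_{\mathbb{R}^d} f(x)e^{-2\pi i x\cdot\gamma}\,dx$ on $L^1(\mathbb{R}^d)$, extended to $L^2(\mathbb{R}^d)$ as usual. For an invertible real $d\times d$ matrix $A$, $(D_Af)(x):=|\det A|^{1/2}f(Ax)$; for $\nu\in\mathbb{R}^d$, $(T_\nu f)(x):=f(x-\nu)$ (here $d=1$ and $D_{c^j}f(x)=c^{j/2}f(c^jx)$). A family $\{f_i\}$ in $L^2$ is a frame if there are $A',B'>0$ with $A'\|f\|_2^2\le\sum_i|\langle f,f_i\rangle|^2\le B'\|f\|_2^2$ for all $f$; a Bessel sequence if the upper inequality holds. Two Bessel sequences $\{D_{c^j}T_{kb}\psi\}$ and $\{D_{c^j}T_{kb}\widetilde\psi\}$ are dual frames if $f=\sum_{j,k}\langle f,D_{c^j}T_{kb}\widetilde\psi\rangle D_{c^j}T_{kb}\psi$ for all $f\in L^2(\mathbb{R})$. *)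

(* Defs.v *)
From HB Require Import structures.
From mathcomp Require Import all_boot all_order all_algebra.
From mathcomp Require Import all_classical all_reals all_analysis.
Set Implicit Arguments. Unset Strict Implicit. Unset Printing Implicit Defensive.
Import Order.TTheory GRing.Theory Num.Theory.
Import numFieldNormedType.Exports.
Local Open Scope classical_set_scope.
Local Open Scope ring_scope.

Section Defs.
Variable R : realType.

Definition Rint (f : R -> R) : R := Rintegral (@lebesgue_measure R) [set: R] f.

Definition Sset (c : R) : set R :=
  [set x | -1 <= x /\ x < - c] `|` [set x | c < x /\ x <= 1].
Definition chiS (c : R) : R -> R := \1_(Sset c).

(* hpre c k = h_{k+1} *)
Fixpoint hpre (c : R) (k : nat) : R -> R :=
  match k with
  | O => chiS c
  | S m => fun g => Rint (fun t => hpre c m t * chiS c (g / `|t|))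
  end.
Definition h (c : R) (n : nat) : R -> R := hpre c n.-1.
Definition Q (c : R) (n : nat) : R := Rint (h c n).

(* complex-valued functions R -> C, represented by (real part, imaginary part) *)
Definition cfun := ((R -> R) * (R -> R))%type.

Definition L2 (f : cfun) : Prop :=
  measurable_fun [set: R] f.1 /\ measurable_fun [set: R] f.2 /\
  (@lebesgue_measure R).-integrable [set: R]
     (fun x => (f.1 x ^+ 2 + f.2 x ^+ 2)%:E).

Definition norm2sq (f : cfun) : R := Rint (fun x => f.1 x ^+ 2 + f.2 x ^+ 2).

(* <f, g> = \int f * conj g, as (real part, imaginary part) *)
Definition inner (f g : cfun) : R * R :=
  (Rint (fun x => f.1 x * g.1 x + f.2 x * g.2 x),
   Rint (fun x => f.2 x * g.1 x - f.1 x * g.2 x)).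

Definition cabs2 (z : R * R) : R := z.1 ^+ 2 + z.2 ^+ 2.

Definition Dil (a : R) (f : cfun) : cfun :=
  (fun x => Num.sqrt `|a| * f.1 (a * x), fun x => Num.sqrt `|a| * f.2 (a * x)).
Definition Tr (nu : R) (f : cfun) : cfun :=
  (fun x => f.1 (x - nu), fun x => f.2 (x - nu)).

Definition wsys (c b : R) (psi : cfun) (jk : int * int) : cfun :=
  Dil (c ^ jk.1) (Tr (jk.2%:~R * b) psi).

Definition Bessel (I : choiceType) (e : I -> cfun) : Prop :=
  (forall i, L2 (e i)) /\
  exists B : R, 0 < B /\ forall f, L2 f ->
    (\esum_(i in [set: I]) (cabs2 (inner f (e i)))%:E <= (B * norm2sq f)%:E)%E.

(* finite partial sum  sum_{i in s} <f, et_i> e_i  (complex scalar times function) *)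
Definition psum (I : Type) (e et : I -> cfun) (f : cfun) (s : seq I) : cfun :=
  (fun x => \sum_(i <- s) ((inner f (et i)).1 * (e i).1 x - (inner f (et i)).2 * (e i).2 x),
   fun x => \sum_(i <- s) ((inner f (et i)).1 * (e i).2 x + (inner f (et i)).2 * (e i).1 x)).

Definition csub (f g : cfun) : cfun := (fun x => f.1 x - g.1 x, fun x => f.2 x - g.2 x).

(* f = sum_i <f, et_i> e_i  with unconditional convergence in L^2 *)
Definition reconstructs (I : choiceType) (e et : I -> cfun) (f : cfun) : Prop :=
  forall eps : R, 0 < eps -> exists F0 : seq I, forall s : seq I,
    uniq s -> {subset F0 <= s} ->
    Num.sqrt (norm2sq (csub f (psum e et f s))) < eps.

Definition dual_frames (I : choiceType) (e et : I -> cfun) : Prop :=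
  Bessel e /\ Bessel et /\ forall f, L2 f -> reconstructs e et f.

(* inverse Fourier transform of an integrable real function g:
   x |-> \int g(gamma) e^{2 pi i x gamma} d gamma *)
Definition invFT (g : R -> R) : cfun :=
  (fun x => Rint (fun y => g y * cos (2 * pi * x * y)),
   fun x => Rint (fun y => g y * sin (2 * pi * x * y))).

Definition psi (c : R) (n : nat) : cfun := invFT (h c n).

Definition psit_hat (c : R) (n : nat) (b : R) : R -> R :=
  fun g => b / (Q c n.-1) ^+ 2 *
    \sum_(i < (n.-1).*2.+1) h c n (c ^ ((i : nat)%:Z - (n.-1)%:Z) * g).
Definition psit (c : R) (n : nat) (b : R) : cfun := invFT (psit_hat c n b).

End Defs.

(* Main.v *)
Require Import Defs.
From HB Require Import structures.
From mathcomp Require Import all_boot all_order all_algebra.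
From mathcomp Require Import all_classical all_reals all_analysis.
From mathcomp Require finmap.
From mathcomp Require Import measurable_realfun.
From mathcomp Require Import zify ring lra.
Set Implicit Arguments. Unset Strict Implicit. Unset Printing Implicit Defensive.
Import Order.TTheory GRing.Theory Num.Theory.
Import numFieldNormedType.Exports.
(* [Rint] of Defs is shadowed by the qualifier of the same name in [reals]. *)
Import Defs.
Local Open Scope classical_set_scope.
Local Open Scope ring_scope.

(** The generator [h_n] is even, so [psi] is real-valued and complex functions
   split into two real ones; on real functions the Hartley transform, with kernel
   [cas = cos + sin], can replace the Fourier transform.

   On an interval of length [1/b] the functions [cas (2 pi k b x)] form an
   orthogonal basis (completeness by convolution with [(1 + cos)^N]).  Parseval
   for all shifts of the sampling lattice, integrated over the shift, gives
   Plancherel on the line; hence Hartley transforms of bounded functions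
   supported away from [0] and infinity are dense in [L^2].

   Since [h_n] and the dual generator live in one interval of length [1/b], the
   expansion over [k] multiplies the transform of [f] by
   [h_n(c^-j x) ht(c^-j x) / b], and these multipliers sum to [1]: the dilates
   [c^j S] tile the punctured line, so [sum_j h_n(c^j x) = Q_(n-1)], and the sum
   defining [ht] contains all dilates overlapping [h_n].  For dense [f] only
   finitely many [j] occur; the general case follows from the Bessel bounds. *)

(** Only functions of class [BC] are ever transformed; a general [f] in [L^2] has no transform here.
    This shapes the frame estimates: they are proved on the synthesis side, where a finite
    combination of atoms is the transform of an explicit [BC] function, and reach arbitrary [f] by
    duality. Nor is an inversion formula proved: the kernel [cas] is symmetric, so the transform is
    self-adjoint on [BC], and self-adjoint plus isometric is enough to recover [u] approximately
    from a cut-off of its transform. The price of the real kernel is that a translation does not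
    become a scalar multiplier: it mixes [g y] with [g (- y)]. For even generators the mixing
    cancels, since odd terms integrate to zero, and translation by [k b] is again a multiplication,
    by [cas (2 pi k b y)]. The bound [b <= c ^+ n.-1 / 2] says that [hper b = 1 / (2 b)] is at least
    the inverse of [c ^+ n.-1], the radius from which on the dual generator vanishes; hence periods
    do not overlap and no alias terms appear. *)

Section Integration.
Variable R : realType.
Implicit Types f g : R -> R.
Local Notation mu := (@lebesgue_measure R).

(** * Integrals over the line: linearity and affine changes of variables *)

Definition integ f := mu.-integrable [set: R] (EFin \o f).

Lemma integ_measurable f : integ f -> measurable_fun [set: R] f.
Proof. by move=> /integrableP[/measurable_EFinP]. Qed.

Lemma integD f g : integ f -> integ g -> integ (fun x => f x + g x).
Proof. by move=> fi gi; exact: (integrableD _ fi gi). Qed.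

Lemma integZ k f : integ f -> integ (fun x => k * f x).
Proof. by move=> fi; exact: (integrableZl _ k fi). Qed.

Lemma integB f g : integ f -> integ g -> integ (fun x => f x - g x).
Proof. by move=> fi gi; exact: (integrableB _ fi gi). Qed.

Lemma integ_sum (I : Type) (s : seq I) (F : I -> R -> R) :
  (forall i, integ (F i)) -> integ (fun x => \sum_(i <- s) F i x).
Proof.
move=> Fi; elim: s => [|i s ih].
  under [X in integ X]funext do rewrite big_nil; exact: integrable0.
by under [X in integ X]funext do rewrite big_cons; exact: integD.
Qed.

Lemma integ_le f g : measurable_fun [set: R] f -> (forall x, `|f x| <= g x) ->
  integ g -> integ f.
Proof.
move=> mf fg; apply: le_integrable => //; first exact/measurable_EFinP.
by move=> x _ /=; rewrite lee_fin (le_trans (fg x))// ler_norm.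
Qed.

Lemma Rint_ext f g : f =1 g -> Rint f = Rint g.
Proof. by move=> /funext ->. Qed.

Lemma RintD f g : integ f -> integ g -> Rint (fun x => f x + g x) = Rint f + Rint g.
Proof. by move=> fi gi; exact: RintegralD. Qed.

Lemma RintB f g : integ f -> integ g -> Rint (fun x => f x - g x) = Rint f - Rint g.
Proof. by move=> fi gi; exact: RintegralB. Qed.

Lemma RintZ k f : integ f -> Rint (fun x => k * f x) = k * Rint f.
Proof. by move=> fi; exact: RintegralZl. Qed.

Lemma Rint_cst0 : Rint (fun _ : R => 0) = 0.
Proof. by rewrite /Rint Rintegral_cst// mul0r. Qed.

Lemma Rint_sum (I : Type) (s : seq I) (F : I -> R -> R) :
  (forall i, integ (F i)) ->
  Rint (fun x => \sum_(i <- s) F i x) = \sum_(i <- s) Rint (F i).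
Proof.
move=> Fi; elim: s => [|i s ih].
  by under Rint_ext do rewrite big_nil; rewrite Rint_cst0 big_nil.
under Rint_ext do rewrite big_cons.
by rewrite RintD ?ih ?big_cons//; exact: integ_sum.
Qed.

Lemma Rint_ge0 f : (forall x, 0 <= f x) -> 0 <= Rint f.
Proof. by move=> f0; apply: Rintegral_ge0. Qed.

Lemma Rint_le f g : integ f -> integ g -> (forall x, f x <= g x) -> Rint f <= Rint g.
Proof. by move=> fi gi fg; apply: le_Rintegral. Qed.

Lemma Rint_norm f : integ f -> `|Rint f| <= Rint (fun x => `|f x|).
Proof. by move=> fi; exact: le_normr_Rintegral. Qed.

Lemma integ_norm f : integ f -> integ (fun x => `|f x|).
Proof. exact: integrable_norm. Qed.

Lemma EFin_Rint f : integ f -> (Rint f)%:E = (\int[mu]_x (f x)%:E)%E.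
Proof. by move=> fi; rewrite fineK//; exact: integrable_fin_num. Qed.

Lemma measurable_affine (a c : R) : measurable_fun [set: R] (fun x : R => a * x + c).
Proof. by apply: measurable_funD => //; exact: measurable_funM. Qed.

(** Lebesgue measure is determined by its values on half-open intervals, so it suffices to compare
    there; for [a < 0] the preimage of []x, y]] is closed on the left instead. *)
Lemma lebesgue_affine (a c : R) (A : set R) : a != 0 -> measurable A ->
  (`|a|%:E * mu ((fun x : R => (a * x + c)%R) @^-1` A))%E = mu A.
Proof.
move=> a0 mA.
pose phi := (fun x : R => a * x + c) : measurableTypeR R -> measurableTypeR R.
have mphi : measurable_fun [set: R] phi by exact: measurable_affine.
pose N := NngNum (normr_ge0 a).
apply/esym.
have := @lebesgue_measure_unique R (mscale N (pushforward mu phi)).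
apply => //=.
move => // _ [[x y]] _ <-.
rewrite /mscale /= /pushforward /=.
have [a1|a1] := ltP 0 a.
  have -> : (phi @^-1` `]x, y]) = `](x - c)/a, (y - c)/a]%classic.
    apply/seteqP; split => t /=; rewrite !in_itv /= /phi ltr_pdivrMr// ler_pdivlMr//; lra.
  rewrite !lebesgue_measure_itv/= !lte_fin ltr_pM2r ?invr_gt0// ltrD2r.
  case: ifPn => // xy; rewrite ?mule0// -!EFinD -EFinM gtr0_norm//; congr EFin.
  by field; lra.
have {}a1 : a < 0 by rewrite lt_neqAle a0.
have -> : (phi @^-1` `]x, y]) = `[(y - c)/a, (x - c)/a[%classic.
  apply/seteqP; split => t /=; rewrite !in_itv /= /phi ltr_ndivlMr// ler_ndivrMr//; lra.
rewrite !lebesgue_measure_itv/= !lte_fin ltr_nM2r ?invr_lt0// ltrD2r.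
case: ifPn => // xy; rewrite ?mule0// -!EFinD -EFinM ltr0_norm//; congr EFin.
by field; lra.
Qed.


Lemma ge0_integral_affine (a c : R) (f : R -> \bar R) : a != 0 ->
  measurable_fun [set: R] f -> (forall x, 0 <= f x)%E ->
  (\int[mu]_x f x = `|a|%:E * \int[mu]_x f (a * x + c)%R)%E.
Proof.
move=> a0 mf f0.
pose phi := (fun x : R => a * x + c) : measurableTypeR R -> measurableTypeR R.
have mphi : measurable_fun [set: R] phi by exact: measurable_affine.
unshelve epose (nu := (pushforward mu phi : {measure set (measurableTypeR R) -> \bar R})).
  exact: mphi.
transitivity (\int[mscale (NngNum (normr_ge0 a)) nu]_x f x)%E.
  apply: eq_measure_integral => A mA _; apply/esym/lebesgue_affine => //.
rewrite ge0_integral_mscale//=; congr (_ * _)%E.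
have := @ge0_integral_pushforward _ _ (measurableTypeR R) (measurableTypeR R) R phi mphi mu setT f measurableT mf.
by rewrite preimage_setT; apply => x _.
Qed.

Lemma measurable_comp_affine (a c : R) f : measurable_fun [set: R] f ->
  measurable_fun [set: R] (fun x => f (a * x + c)).
Proof. by move=> mf; apply: measurableT_comp => //; exact: measurable_affine. Qed.

Lemma integ_affine (a c : R) f : a != 0 -> integ f -> integ (fun x => f (a * x + c)).
Proof.
move=> a0 fi; have mf := integ_measurable fi.
apply/integrableP; split; first by apply/measurable_EFinP; exact: measurable_comp_affine.
move/integrableP : fi => [_].
rewrite (@ge0_integral_affine a c)//=; last first.
  by apply/measurable_EFinP; exact: measurableT_comp.
apply: contraTT; rewrite -!leNgt !leye_eq => /eqP ->.
by rewrite gt0_muley// lte_fin normr_gt0.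
Qed.

(** Positive and negative parts reduce this to the nonnegative formula in the extended reals. *)
Lemma Rint_affine (a c : R) f : a != 0 -> integ f ->
  Rint f = `|a| * Rint (fun x => f (a * x + c)).
Proof.
move=> a0 fi; have mf := integ_measurable fi.
have pm : measurable_fun [set: R] (fun x => Num.max (f x) 0) by exact: measurable_maxr.
have nm : measurable_fun [set: R] (fun x => Num.max (- f x) 0).
  by apply: measurable_maxr => //; exact: measurableT_comp.
have pi : integ (fun x => Num.max (f x) 0).
  apply: (integ_le pm) (integ_norm fi) => x.
  by rewrite ger0_norm ?le_max ?lexx ?orbT// ge_max ler_norm normr_ge0.
have ni : integ (fun x => Num.max (- f x) 0).
  apply: (integ_le nm) (integ_norm fi) => x.
  by rewrite ger0_norm ?le_max ?lexx ?orbT// ge_max -normrN ler_norm normr_ge0.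
have E g : integ g -> (forall x, 0 <= g x) ->
    Rint g = `|a| * Rint (fun x => g (a * x + c)).
  move=> gi g0; apply: EFin_inj; rewrite EFinM !EFin_Rint ?integ_affine//.
  have mg : measurable_fun [set: R] (fun x => (g x)%:E).
    by apply/measurable_EFinP; exact: integ_measurable.
  by rewrite (@ge0_integral_affine a c).
have fE x : f x = Num.max (f x) 0 - Num.max (- f x) 0.
  by case: (ltP (f x) 0) => h; case: (ltP (- f x) 0) => h'; lra.
rewrite (Rint_ext fE) RintB// E ?[Rint (fun x => Num.max (- f x) 0)]E//; last 2 first.
- by move=> x; rewrite le_max lexx orbT.
- by move=> x; rewrite le_max lexx orbT.
rewrite -mulrBr -RintB; last 2 first.
- exact: (integ_affine _ a0 pi).
- exact: (integ_affine _ a0 ni).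
by under [in RHS]Rint_ext do rewrite fE.
Qed.

Lemma integ_dil (a : R) f : a != 0 -> integ f -> integ (fun x => f (a * x)).
Proof.
move=> a0 /(integ_affine 0 a0); by under [X in integ X]funext do rewrite addr0.
Qed.

Lemma Rint_dil (a : R) f : a != 0 -> integ f ->
  Rint f = `|a| * Rint (fun x => f (a * x)).
Proof.
move=> a0 /(Rint_affine 0 a0) ->; by under Rint_ext do rewrite addr0.
Qed.

Lemma integ_opp f : integ f -> integ (fun x => f (- x)).
Proof.
move=> fi; under [X in integ X]funext => x do rewrite -mulN1r.
by apply: integ_dil => //; rewrite oppr_eq0 oner_eq0.
Qed.

Lemma Rint_opp f : integ f -> Rint (fun x => f (- x)) = Rint f.
Proof.
move=> fi; rewrite (@Rint_dil (-1) f) ?oppr_eq0 ?oner_eq0// normrN1 mul1r.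
by apply: Rint_ext => x; rewrite mulN1r.
Qed.

Lemma Rint_odd f : integ f -> (forall x, f (- x) = - f x) -> Rint f = 0.
Proof.
move=> fi fodd; have := Rint_opp fi; rewrite (Rint_ext fodd).
under Rint_ext do rewrite -mulN1r; rewrite RintZ//; lra.
Qed.

(** * Bounded measurable functions, with and without bounded support *)

Definition BM f := measurable_fun [set: R] f /\ exists M, forall x, `|f x| <= M.

(** The working class for transforms: it lies in [L^1] and in [L^2] and is stable under sums,
    dilations and bounded multipliers, so integrability goals are met structurally. *)
Definition BC f := BM f /\ exists r, forall x, r < `|x| -> f x = 0.

Lemma BM_cst k : BM (fun _ => k).
Proof. by split => //; exists `|k|. Qed.

Lemma BMM f g : BM f -> BM g -> BM (fun x => f x * g x).
Proof.
move=> [mf [M fM]] [mg [N gN]]; split; first exact: measurable_funM.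
by exists (M * N) => x; rewrite normrM ler_pM.
Qed.

Lemma BMD f g : BM f -> BM g -> BM (fun x => f x + g x).
Proof.
move=> [mf [M fM]] [mg [N gN]]; split; first exact: measurable_funD.
by exists (M + N) => x; rewrite (le_trans (ler_normD _ _))// lerD.
Qed.

Lemma BMZ k f : BM f -> BM (fun x => k * f x).
Proof. exact/BMM/BM_cst. Qed.

Lemma BM_indic (A : set R) : measurable A -> BM (\1_A).
Proof.
move=> mA; split; first exact: measurable_indic.
by exists 1 => x; rewrite indicE; case: (x \in A); rewrite ?normr1 ?normr0.
Qed.

Lemma BM_dil (a c : R) f : BM f -> BM (fun x => f (a * x + c)).
Proof.
by move=> [mf [M fM]]; split; [exact: measurable_comp_affine|exists M].
Qed.

Lemma BCM f g : BC f -> BM g -> BC (fun x => f x * g x).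
Proof.
move=> [bf [r fr]] bg; split; first exact: BMM.
by exists r => x /fr ->; rewrite mul0r.
Qed.

Lemma BCD f g : BC f -> BC g -> BC (fun x => f x + g x).
Proof.
move=> [bf [r fr]] [bg [s gs]]; split; first exact: BMD.
exists (Num.max r s) => x; rewrite gt_max => /andP[/fr -> /gs ->].
by rewrite addr0.
Qed.

Lemma BCZ k f : BC f -> BC (fun x => k * f x).
Proof.
move=> fb; under [X in BC X]funext do rewrite mulrC.
by apply: BCM => //; exact: BM_cst.
Qed.

Lemma BCB f g : BC f -> BC g -> BC (fun x => f x - g x).
Proof.
move=> fb gb; under [X in BC X]funext do rewrite -mulN1r.
by apply: BCD => //; exact: BCZ.
Qed.

Lemma BC0 : BC (fun _ => 0).
Proof. by split; [exact: BM_cst|exists 0]. Qed.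

Lemma BC_sum (I : Type) (s : seq I) (F : I -> R -> R) :
  (forall i, BC (F i)) -> BC (fun x => \sum_(i <- s) F i x).
Proof.
move=> Fi; elim: s => [|i s ih].
  under [X in BC X]funext do rewrite big_nil; exact: BC0.
by under [X in BC X]funext do rewrite big_cons; exact: BCD.
Qed.

Lemma BC_dil (a : R) f : a != 0 -> BC f -> BC (fun x => f (a * x)).
Proof.
move=> a0 [bf [r fr]]; split.
  by have := BM_dil a 0 bf; under [X in BM X]funext do rewrite addr0.
exists (r / `|a|) => x; rewrite ltr_pdivrMr ?normr_gt0// => rx.
by rewrite fr// normrM mulrC.
Qed.

Lemma BC_indic (r : R) : BC (\1_(`[- r, r])).
Proof.
split; first exact: BM_indic.
exists r => x rx; rewrite indicE memNset//= in_itv/= => /andP[h1 h2].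
by move: rx; rewrite ltNge ler_norml h1 h2.
Qed.

Lemma BC_integ f : BC f -> integ f.
Proof.
move=> [[mf [M fM]] [r fr]].
apply: (@integ_le _ (fun x => M * \1_(`[- r, r]) x)) => // [x|].
  rewrite indicE; case: (boolP (x \in _)) => [_|]; first by rewrite mulr1.
  rewrite notin_setE/= in_itv/= -ler_norml => /negP; rewrite -ltNge => /fr ->.
  by rewrite normr0 mulr0.
by apply: integZ; exact: integrable_indic_itv.
Qed.

(** * Geometry of square-integrable real functions *)

Definition SQ f := measurable_fun [set: R] f /\ integ (fun x => f x ^+ 2).

Definition nrm f := Rint (fun x => f x ^+ 2).

Definition ip f g := Rint (fun x => f x * g x).

Lemma BC_SQ f : BC f -> SQ f.
Proof.
move=> fb; split; first by case: fb => -[].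
by apply: BC_integ; under [X in BC X]funext do rewrite expr2; apply: BCM => //; case: fb.
Qed.

Lemma SQM_integ f g : SQ f -> SQ g -> integ (fun x => f x * g x).
Proof.
move=> [mf f2] [mg g2].
apply: (@integ_le _ (fun x => f x ^+ 2 + g x ^+ 2)) (integD f2 g2).
  exact: measurable_funM.
move=> x; rewrite normrM -(real_normK (num_real (f x))) -(real_normK (num_real (g x))).
have := sqr_ge0 (`|f x| - `|g x|); have := normr_ge0 (f x); have := normr_ge0 (g x).
nra.
Qed.

Lemma SQD f g : SQ f -> SQ g -> SQ (fun x => f x + g x).
Proof.
move=> sf sg; split; first by apply: measurable_funD; [case: sf|case: sg].
under [X in integ X]funext do rewrite sqrrD -mulr_natl.
by apply: integD (proj2 sg); apply: integD (proj2 sf) _; exact/integZ/SQM_integ.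
Qed.

Lemma SQZ k f : SQ f -> SQ (fun x => k * f x).
Proof.
move=> [mf sf]; split; first exact: measurable_funM.
by under [X in integ X]funext do rewrite exprMn; exact: integZ.
Qed.

Lemma SQB f g : SQ f -> SQ g -> SQ (fun x => f x - g x).
Proof.
move=> sf sg; under [X in SQ X]funext do rewrite -mulN1r.
by apply: SQD => //; exact: SQZ.
Qed.

Lemma SQ_sum (I : Type) (s : seq I) (F : I -> R -> R) :
  (forall i, SQ (F i)) -> SQ (fun x => \sum_(i <- s) F i x).
Proof.
move=> Fi; elim: s => [|i s ih].
  under [X in SQ X]funext do rewrite big_nil; exact/BC_SQ/BC0.
by under [X in SQ X]funext do rewrite big_cons; exact: SQD.
Qed.

Lemma nrm_ge0 f : 0 <= nrm f.
Proof. by apply: Rint_ge0 => x; exact: sqr_ge0. Qed.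

Lemma ipC f g : ip f g = ip g f.
Proof. by apply: Rint_ext => x; rewrite mulrC. Qed.

Lemma ipDl f g k : SQ f -> SQ g -> SQ k -> ip (fun x => f x + g x) k = ip f k + ip g k.
Proof.
move=> sf sg sk; rewrite /ip -RintD; [|exact: SQM_integ..].
by apply: Rint_ext => x; rewrite mulrDl.
Qed.

Lemma ipZl a f k : SQ f -> SQ k -> ip (fun x => a * f x) k = a * ip f k.
Proof.
move=> sf sk; rewrite /ip -RintZ; [|exact: SQM_integ].
by apply: Rint_ext => x; rewrite mulrA.
Qed.

Lemma ipBl f g k : SQ f -> SQ g -> SQ k -> ip (fun x => f x - g x) k = ip f k - ip g k.
Proof.
move=> sf sg sk; rewrite /ip -RintB; [|exact: SQM_integ..].
by apply: Rint_ext => x; rewrite mulrBl.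
Qed.

Lemma ip_suml (I : Type) (s : seq I) (F : I -> R -> R) k : SQ k ->
  (forall i, SQ (F i)) -> ip (fun x => \sum_(i <- s) F i x) k = \sum_(i <- s) ip (F i) k.
Proof.
move=> sk sF; rewrite /ip -Rint_sum => [|i]; last exact: SQM_integ.
by apply: Rint_ext => x; rewrite mulr_suml.
Qed.

Lemma nrmE f : nrm f = ip f f.
Proof. by apply: Rint_ext => x; rewrite expr2. Qed.

Lemma nrmD f g : SQ f -> SQ g ->
  nrm (fun x => f x + g x) = nrm f + 2 * ip f g + nrm g.
Proof.
move=> sf sg; have sfg := SQD sf sg.
rewrite !nrmE ipDl// !(ipC _ (fun x => f x + g x)) !ipDl// (ipC g f); lra.
Qed.

Lemma nrmZ a f : SQ f -> nrm (fun x => a * f x) = a ^+ 2 * nrm f.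
Proof.
move=> [_ sf]; rewrite /nrm -RintZ//.
by apply: Rint_ext => x; rewrite exprMn.
Qed.

Lemma nrmB f g : SQ f -> SQ g ->
  nrm (fun x => f x - g x) = nrm f - 2 * ip f g + nrm g.
Proof.
move=> sf sg; have sfg := SQB sf sg.
rewrite !nrmE ipBl// !(ipC _ (fun x => f x - g x)) !ipBl// (ipC g f); lra.
Qed.

Lemma cauchy_schwarz f g : SQ f -> SQ g -> (ip f g) ^+ 2 <= nrm f * nrm g.
Proof.
move=> sf sg.
have P t : 0 <= nrm f - 2 * t * ip f g + t ^+ 2 * nrm g.
  by have := nrm_ge0 (fun x => f x - t * g x);
    rewrite nrmB ?nrmZ//; [rewrite ipC ipZl// ipC mulrA|exact: SQZ].
have := nrm_ge0 g; rewrite le_eqVlt => /predU1P[g0|g0].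
  have [->|ip0] := eqVneq (ip f g) 0; first by rewrite expr0n mulr_ge0// nrm_ge0.
  (* With [nrm g = 0] the polynomial is affine in [t]; at this point it equals [- 1]. *)
  have := P ((nrm f + 1) / (2 * ip f g)); rewrite -g0 mulr0 addr0.
  have -> : 2 * ((nrm f + 1) / (2 * ip f g)) * ip f g = nrm f + 1 by field.
  lra.
have := P (ip f g / nrm g).
have -> : nrm f - 2 * (ip f g / nrm g) * ip f g + (ip f g / nrm g) ^+ 2 * nrm g
   = (nrm f * nrm g - ip f g ^+ 2) / nrm g by field; rewrite gt_eqF.
by rewrite pmulr_lge0 ?invr_gt0// subr_ge0.
Qed.

(** [nrm] is the squared norm, so this replaces the triangle inequality; by the parallelogram law
    the slack is [nrm] of [f - g]. *)
Lemma nrmD_le f g : SQ f -> SQ g ->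
  nrm (fun x => f x + g x) <= 2 * nrm f + 2 * nrm g.
Proof.
move=> sf sg; have := nrm_ge0 (fun x => f x - g x).
rewrite (nrmD sf sg) (nrmB sf sg); lra.
Qed.

Lemma nrmB_le f g : SQ f -> SQ g ->
  nrm (fun x => f x - g x) <= 2 * nrm f + 2 * nrm g.
Proof.
move=> sf sg; have := nrm_ge0 (fun x => f x + g x).
rewrite (nrmD sf sg) (nrmB sf sg); lra.
Qed.

End Integration.

(** * Dominated convergence for real integrals *)

Section DominatedConvergence.
Variable R : realType.

Lemma Rint_dominated (F : nat -> R -> R) (f g : R -> R) :
  (forall n, measurable_fun [set: R] (F n)) -> integ g ->
  (forall x, F n x @[n --> \oo] --> f x) -> (forall n x, `|F n x| <= g x) ->
  integ f /\ Rint (F n) @[n --> \oo] --> Rint f.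
Proof.
move=> mF gi Ff Fg.
have mf : measurable_fun [set: R] f.
  by apply: (@measurable_fun_cvg _ _ _ _ F) => // x _; exact: Ff.
have Fi n : integ (F n) by apply: integ_le (Fg n) gi.
have [] := @dominated_convergence _ _ R (@lebesgue_measure R) setT measurableT
  (fun n x => (F n x)%:E) (fun x => (f x)%:E) (fun x => (g x)%:E).
- by move=> n; apply/measurable_EFinP; exact: mF.
- by apply/measurable_EFinP; exact: mf.
- apply: aeW => x _; apply: cvg_EFin; last exact: Ff.
  by apply: nearW => n.
- exact: gi.
- by apply: aeW => x n _; rewrite lee_fin.
move=> fi _ cv; split => //.
have -> : (fun n => Rint (F n)) = fine \o (fun n => (\int[lebesgue_measure]_x (F n x)%:E)%E) by [].
by apply: fine_cvg; rewrite fineK//; exact: integrable_fin_num.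
Qed.

Lemma cvg_to0P (u : nat -> R) (e : R) : u n @[n --> \oo] --> (0:R) -> 0 < e ->
  exists N, forall n, (N <= n)%N -> `|u n| < e.
Proof.
move=> /cvgrPdist_lt /(_ e) + e0 => /(_ e0) [N _ NP].
by exists N => n Nn; have := NP n Nn; rewrite sub0r normrN.
Qed.

End DominatedConvergence.

(** * The kernel [cas] and integrals over symmetric intervals *)

Section Trigonometry.
Variable R : realType.

Definition cas (x : R) := cos x + sin x.

(** The sine term is the useful one to isolate: against an even weight it integrates to zero,
    leaving the cosine of the difference, as for complex exponentials. *)
Lemma casM a b : cas a * cas b = cos (a - b) + sin (a + b).
Proof. by rewrite /cas cosB sinD; ring. Qed.

Lemma casMcos a b : cas a * cos b = 2^-1 * cas (a + b) + 2^-1 * cas (a - b).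
Proof. by rewrite /cas cosB sinD cosD sinB; field. Qed.

Lemma casN a : cas (- a) = cos a - sin a.
Proof. by rewrite /cas cosN sinN. Qed.

(** A shift of the argument brings in the reflected value [cas (- a)]: the origin of the reflected
    terms in [casB_lin] and [rotate]. *)
Lemma casB a b : cas (a - b) = cos b * cas a + - sin b * cas (- a).
Proof. by rewrite casN /cas cosB sinB; ring. Qed.

Lemma cas_le2 x : `|cas x| <= 2.
Proof.
rewrite (le_trans (ler_normD _ _))// -[2]/(1 + 1 : R) lerD// ler_norml.
  by rewrite cos_geN1 cos_le1.
by rewrite sin_geN1 sin_le1.
Qed.

Lemma continuous_cas : continuous cas.
Proof. by move=> x; apply: continuousD; [exact: continuous_cos|exact: continuous_sin]. Qed.

Lemma BM_cas_lin (w : R) : BM (fun x => cas (w * x)).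
Proof.
split; last by exists 2 => x; exact: cas_le2.
apply: continuous_measurable_fun => x; apply: continuous_comp; last exact: continuous_cas.
exact: mulrl_continuous.
Qed.

Lemma BM_cos_lin (w : R) : BM (fun x => cos (w * x)).
Proof.
split; last by exists 1 => x; rewrite ler_norml cos_geN1 cos_le1.
apply: continuous_measurable_fun => x; apply: continuous_comp; last exact: continuous_cos.
exact: mulrl_continuous.
Qed.

Lemma BM_sin_lin (w : R) : BM (fun x => sin (w * x)).
Proof.
split; last by exists 1 => x; rewrite ler_norml sin_geN1 sin_le1.
apply: continuous_measurable_fun => x; apply: continuous_comp; last exact: continuous_sin.
exact: mulrl_continuous.
Qed.

Lemma sin_intpi (m : int) : sin (pi * m%:~R : R) = 0.
Proof.
have H (n : nat) : sin (pi * n%:R : R) = 0.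
  elim: n => [|n ih]; first by rewrite mulr0 sin0.
  by rewrite -natr1 mulrDr mulr1 sinDpi ih oppr0.
case: m => n; first by rewrite H.
by rewrite NegzE mulrNz mulrN sinN H oppr0.
Qed.

Lemma Rint_indicM (A : set R) (f : R -> R) :
  Rint (fun x => \1_A x * f x) = Rintegral lebesgue_measure A f.
Proof.
rewrite /Rint [RHS]Rintegral_mkcond; apply: eq_Rintegral => x _.
rewrite patchE indicE; case: ifPn => _; rewrite ?mul1r ?mul0r//.
Qed.

Variable r : R.

Local Notation I := (\1_(`]- r, r[) : R -> R).

Lemma BC_open_indic : BC I.
Proof.
have := BCM (BC_indic r) (@BM_indic R _ (measurable_itv `]- r, r[)).
congr BC; apply/funext => x; rewrite !indicE.
case: (boolP (x \in `]- r, r[%classic)) => [|_]; last by rewrite mulr0.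
rewrite inE /= in_itv/= => /andP[a b].
by rewrite mem_set ?mulr1//= in_itv/= !ltW.
Qed.

Lemma open_indicE (x : R) : I x = ((`|x| < r)%R)%:R.
Proof.
rewrite indicE; congr (nat_of_bool _)%:R.
by apply/idP/idP; rewrite ?inE /= in_itv/= ltr_norml.
Qed.

Lemma Rint_open_indic : 0 < r -> Rint I = 2 * r.
Proof.
move=> r0; rewrite -(Rint_ext (fun x => mulr1 _)) Rint_indicM Rintegral_cst// mul1r.
apply: etrans (congr1 fine (lebesgue_measure_itv `]- r, r[)) _ => /=.
rewrite lte_fin; have -> : (- r < r) by lra.
by rewrite /= opprK mulr_natl mulr2n.
Qed.

Lemma BM_integI f : BM f -> integ (fun x => I x * f x).
Proof. by move=> bf; apply/BC_integ/BCM => //; exact: BC_open_indic. Qed.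

Lemma Rint_cos (w : R) : 0 < r -> w != 0 -> Rint (fun x => I x * cos (w * x)) = 2 * sin (w * r) / w.
Proof.
move=> r0 w0.
have rr : - r < r by lra.
have ci : (@lebesgue_measure R).-integrable `[- r, r] (EFin \o (fun x => cos (w * x))).
  apply: continuous_compact_integrable; first exact: segment_compact.
  apply: continuous_subspaceT => x; apply: continuous_comp; last exact: continuous_cos.
  exact: mulrl_continuous.
(* The fundamental theorem of calculus is applied on the closed interval; the two endpoints are
   null. *)
rewrite Rint_indicM.
rewrite Rintegral_itv_obnd_cbnd; last first.
  by apply: integrableS ci => //= z /=; rewrite !in_itv/=; lra.
rewrite Rintegral_itv_bndo_bndc; last first.
  by apply: integrableS ci => //= z /=; rewrite !in_itv/=; lra.
pose F x := w^-1 * sin (w * x).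
have dF (x : R) : is_derive x 1 F (cos (w * x)).
  have d1 : is_derive x 1 (fun y : R => w * y) w.
    have := @is_deriveZ _ _ _ id w x 1 1 (is_derive_id _ _).
    by rewrite /GRing.scale /= mulr1.
  have d2 : is_derive x 1 (fun y : R => sin (w * y)) (w * cos (w * x)).
    have := @is_derive1_comp _ sin (fun y : R => w * y) x _ _ (is_derive_sin _) d1.
    by rewrite mulrC.
  have := @is_deriveZ _ _ _ _ w^-1 x 1 _ d2.
  by rewrite /GRing.scale /= mulKf.
have cF : continuous F.
  move=> x; apply: differentiable_continuous; apply/derivable1_diffP.
  by case: (dF x).
rewrite /Rintegral (@continuous_FTC2 _ _ F)//=.
- by rewrite /F mulrN sinN; field.
- apply: continuous_subspaceT => x; apply: continuous_comp; last exact: continuous_cos.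
  exact: mulrl_continuous.
- split => [x _||]; first by case: (dF x).
  + by apply: cvg_at_right_filter; exact: cF.
  + by apply: cvg_at_left_filter; exact: cF.
- by move=> x _; rewrite derive1E; apply: derive_val.
Qed.

Lemma Rint_sin (w : R) : Rint (fun x => I x * sin (w * x)) = 0.
Proof.
apply: Rint_odd; first exact/BM_integI/BM_sin_lin.
by move=> x; rewrite !open_indicE normrN mulrN sinN mulrN.
Qed.

End Trigonometry.

(** * The trigonometric system on one period and convolution with a polynomial kernel *)

Section TrigSystem.
Variables (R : realType) (b : R).

Definition frq (k : int) : R := 2 * pi * (k%:~R * b).
(** Half of the common period [1 / b] of the functions [cas (frq k * x)]. *)
Definition hper : R := (2 * b)^-1.
Definition Iper : R -> R := \1_(`]- hper, hper[).
Definition tri (k : int) : R -> R := fun x => Iper x * cas (frq k * x).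

Lemma hper_gt0 : 0 < b -> 0 < hper.
Proof. by move=> b0; rewrite invr_gt0 mulr_gt0. Qed.

Lemma Iper_idem x : Iper x * Iper x = Iper x.
Proof. by rewrite /Iper open_indicE; case: ltP; rewrite ?mulr1 ?mulr0. Qed.

Lemma Iper_ge0 x : 0 <= Iper x.
Proof. by rewrite /Iper open_indicE. Qed.

Lemma Iper_in x : `|x| < hper -> Iper x = 1.
Proof. by move=> h; rewrite /Iper open_indicE h. Qed.

Lemma Iper_out x : hper <= `|x| -> Iper x = 0.
Proof. by move=> h; rewrite /Iper open_indicE ltNge h. Qed.

Lemma BC_Iper : BC Iper.
Proof. exact: BC_open_indic. Qed.

Lemma BC_Iper_mul f : BM f -> BC (fun x => Iper x * f x).
Proof. by move=> bf; apply: BCM => //; exact: BC_Iper. Qed.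

Lemma Rint_Iper : 0 < b -> Rint Iper = b^-1.
Proof.
move=> b0; rewrite /Iper Rint_open_indic ?hper_gt0// /hper.
by field; rewrite gt_eqF.
Qed.

Lemma BC_tri k : BC (tri k).
Proof. by apply: BC_Iper_mul; exact: BM_cas_lin. Qed.

Lemma SQ_tri k : SQ (tri k). Proof. exact/BC_SQ/BC_tri. Qed.

Lemma frqB k l : frq (k - l) = frq k - frq l.
Proof. by rewrite /frq rmorphB /=; ring. Qed.

Lemma frqD k l : frq (k + l) = frq k + frq l.
Proof. by rewrite /frq rmorphD /=; ring. Qed.

Lemma frqN k : frq (- k) = - frq k.
Proof. by rewrite /frq rmorphN /=; ring. Qed.

Lemma frq0 : frq 0 = 0.
Proof. by rewrite /frq mul0r mulr0. Qed.

Lemma Rint_cos_frq k : 0 < b ->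
  Rint (fun x => Iper x * cos (frq k * x)) = if k == 0 then b^-1 else 0.
Proof.
move=> b0; case: eqVneq => [->|k0].
  under Rint_ext do rewrite frq0 mul0r cos0 mulr1; exact: Rint_Iper.
have f0 : frq k != 0.
  by rewrite /frq !mulf_neq0// ?intr_eq0// gt_eqF// pi_gt0.
rewrite /Iper Rint_cos ?hper_gt0//.
have -> : frq k * hper = pi * k%:~R.
  by rewrite /frq /hper; field; rewrite gt_eqF.
by rewrite sin_intpi mulr0 mul0r.
Qed.

Lemma Rint_sin_frq k : Rint (fun x => Iper x * sin (frq k * x)) = 0.
Proof. exact: Rint_sin. Qed.

(** By [casM] the product is a cosine at frequency [k - l] plus a sine at [k + l], and the sine has
    integral zero. *)
Lemma ip_tri k l : 0 < b -> ip (tri k) (tri l) = if k == l then b^-1 else 0.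
Proof.
move=> b0; rewrite -subr_eq0 -Rint_cos_frq// -[RHS]addr0 -(Rint_sin_frq (k + l)).
rewrite -RintD; [|exact/BM_integI/BM_cos_lin|exact/BM_integI/BM_sin_lin].
apply: Rint_ext => x; rewrite /tri mulrACA Iper_idem casM frqB frqD.
by rewrite mulrDr mulrBl mulrDl.
Qed.

Lemma ip_sum_tri (s : seq int) (a : int -> R) m : 0 < b -> uniq s -> m \in s ->
  ip (fun x => \sum_(k <- s) a k * tri k x) (tri m) = a m / b.
Proof.
move=> b0 us ms; rewrite ip_suml; [|exact: SQ_tri|by move=> k; exact/SQZ/SQ_tri].
rewrite (bigD1_seq m)//= big1 ?addr0 => [|k km]; rewrite ipZl ?ip_tri//; try exact: SQ_tri.
  by rewrite eqxx.
by rewrite (negPf km) mulr0.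
Qed.

Lemma nrm_sum_tri (s : seq int) (a : int -> R) : 0 < b -> uniq s ->
  nrm (fun x => \sum_(k <- s) a k * tri k x) = b^-1 * \sum_(k <- s) a k ^+ 2.
Proof.
move=> b0 us; rewrite nrmE {1}ip_suml; last 2 first.
- by apply: SQ_sum => k; exact/SQZ/SQ_tri.
- by move=> k; exact/SQZ/SQ_tri.
rewrite mulr_sumr big_seq [RHS]big_seq; apply: eq_bigr => k ks.
have st := SQ_tri; rewrite ipZl//; last by apply: SQ_sum => j; exact: SQZ.
by rewrite ipC ip_sum_tri// expr2; ring.
Qed.

(** For distinct entries of [s], the orthogonal projection onto the span of the [tri k]; the factor
    [b] compensates [nrm (tri k) = b^-1]. *)
Definition projtri (s : seq int) (G : R -> R) : R -> R :=
  fun x => \sum_(k <- s) (b * ip G (tri k)) * tri k x.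

Lemma SQ_projtri s G : SQ (projtri s G).
Proof. by apply: SQ_sum => k; exact/SQZ/SQ_tri. Qed.

Lemma nrm_projtri s G : 0 < b -> uniq s -> SQ G ->
  nrm (fun x => G x - projtri s G x) = nrm G - b * \sum_(k <- s) ip G (tri k) ^+ 2.
Proof.
move=> b0 us sG; have st := SQ_tri.
have A : ip G (projtri s G) = b * \sum_(k <- s) ip G (tri k) ^+ 2.
  rewrite ipC ip_suml//; last by move=> k; exact: SQZ.
  rewrite mulr_sumr; apply: eq_bigr => k _.
  by rewrite ipZl// (ipC (tri k)) expr2 mulrA.
have B : nrm (projtri s G) = b * \sum_(k <- s) ip G (tri k) ^+ 2.
  rewrite nrm_sum_tri// !mulr_sumr; apply: eq_bigr => k _.
  by field; rewrite gt_eqF.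
rewrite nrmB//; last exact: SQ_projtri.
by rewrite A B; ring.
Qed.

Lemma bessel_tri s G : 0 < b -> uniq s -> SQ G ->
  b * \sum_(k <- s) ip G (tri k) ^+ 2 <= nrm G.
Proof. by move=> b0 us sG; rewrite -subr_ge0 -nrm_projtri// nrm_ge0. Qed.

(** Frequencies may repeat in the list, so that a sum is a concatenation and no coefficients have to
    be merged. *)
Definition tpoly (f : R -> R) :=
  exists l : seq (R * int), forall x, f x = \sum_(p <- l) p.1 * cas (frq p.2 * x).

Lemma tpolyD f g : tpoly f -> tpoly g -> tpoly (fun x => f x + g x).
Proof. by move=> [l fl] [m gm]; exists (l ++ m) => x; rewrite big_cat /= fl gm. Qed.

Lemma tpolyZ a f : tpoly f -> tpoly (fun x => a * f x).
Proof.
move=> [l fl]; exists [seq (a * p.1, p.2) | p <- l] => x.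
by rewrite fl big_map mulr_sumr; apply: eq_bigr => p _; rewrite mulrA.
Qed.

Lemma tpoly_cas k : tpoly (fun x => cas (frq k * x)).
Proof. by exists [:: (1, k)] => x; rewrite big_seq1 mul1r. Qed.

Lemma tpoly_sum (I : Type) (s : seq I) (F : I -> R -> R) :
  (forall i, tpoly (F i)) -> tpoly (fun x => \sum_(i <- s) F i x).
Proof.
move=> tF; elim: s => [|i s ih]; first by exists [::] => x; rewrite !big_nil.
by under [X in tpoly X]funext do rewrite big_cons; exact: tpolyD.
Qed.

Lemma tpolyMcos f : tpoly f -> tpoly (fun x => f x * cos (frq 1 * x)).
Proof.
move=> [l fl].
have -> : (fun x => f x * cos (frq 1 * x)) =
  (fun x => \sum_(p <- l) p.1 * (2^-1 * cas (frq (p.2 + 1) * x) + 2^-1 * cas (frq (p.2 - 1) * x))).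
  apply/funext => x; rewrite fl mulr_suml; apply: eq_bigr => p _.
  by rewrite -mulrA casMcos frqD frqB mulrDl mulrBl.
apply: tpoly_sum => p; apply: tpolyZ; apply: tpolyD; apply: tpolyZ; exact: tpoly_cas.
Qed.

(** Up to normalisation the de la Vallee Poussin kernel: visibly nonnegative, a trigonometric
    polynomial by induction on [N], and peaked at [0]. *)
Definition ker (N : nat) (x : R) : R := (1 + cos (frq 1 * x)) ^+ N.

Lemma tpoly_ker N : tpoly (ker N).
Proof.
elim: N => [|N ih].
  exists [:: (1, 0%Z)] => x.
  by rewrite big_seq1 /ker expr0 /= frq0 mul0r /cas cos0 sin0 addr0 mulr1.
have -> : ker N.+1 = (fun x => ker N x + ker N x * cos (frq 1 * x)).
  by apply/funext => x; rewrite /ker exprSr mulrDr mulr1.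
exact/tpolyD/tpolyMcos.
Qed.

Lemma ker_ge0 N x : 0 <= ker N x.
Proof. by rewrite exprn_ge0// -lerBlDl sub0r cos_geN1. Qed.

Lemma BM_ker N (y : R) : BM (fun t => ker N (y - t)).
Proof.
elim: N => [|N ih]; first by under [X in BM X]funext do rewrite /ker expr0; exact: BM_cst.
under [X in BM X]funext do rewrite /ker exprSr.
apply: BMM => //; apply: BMD; first exact: BM_cst.
under [X in BM X]funext do rewrite mulrDr mulrN cosB.
by apply: BMD; apply: BMM; by [exact: BM_cst|exact: BM_cos_lin|exact: BM_sin_lin].
Qed.

Lemma kerN N x : ker N (- x) = ker N x.
Proof. by rewrite /ker mulrN cosN. Qed.

Lemma casB_lin k y t : cas (frq k * (y - t)) =
  cos (frq k * t) * cas (frq k * y) + - sin (frq k * t) * cas (frq (- k) * y).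
Proof. by rewrite mulrBr casB frqN (mulNr (frq k) y). Qed.

Definition kconv (f : R -> R) N y := Rint (fun t => Iper t * f t * ker N (y - t)).

(** Expanding [ker N (y - t)] by [casB_lin] separates [y] from [t]; the integrals over [t] become
    coefficients. *)
Lemma tpoly_kconv f N : BM f -> tpoly (kconv f N).
Proof.
move=> bf; have [l kl] := tpoly_ker N.
have bif := BC_Iper_mul bf.
have -> : kconv f N = (fun y => \sum_(p <- l) p.1 *
   (Rint (fun t => Iper t * f t * cos (frq p.2 * t)) * cas (frq p.2 * y) +
    - Rint (fun t => Iper t * f t * sin (frq p.2 * t)) * cas (frq (- p.2) * y))).
  apply/funext => y; rewrite /kconv; under Rint_ext do rewrite kl mulr_sumr.
  have ic k : integ (fun t => Iper t * f t * cos (frq k * t)).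
    by apply: BC_integ; apply: BCM bif _; exact: BM_cos_lin.
  have is_ k : integ (fun t => Iper t * f t * sin (frq k * t)).
    by apply: BC_integ; apply: BCM bif _; exact: BM_sin_lin.
  have E (p : R * int) t : Iper t * f t * (p.1 * cas (frq p.2 * (y - t))) =
     p.1 * cas (frq p.2 * y) * (Iper t * f t * cos (frq p.2 * t)) +
     (- p.1 * cas (frq (- p.2) * y)) * (Iper t * f t * sin (frq p.2 * t)).
    by rewrite casB_lin; ring.
  under Rint_ext do under eq_bigr do rewrite E.
  rewrite Rint_sum => [|p]; last by apply: integD; exact: integZ.
  apply: eq_bigr => p _; rewrite RintD; [|exact: integZ..].
  by rewrite !RintZ//; ring.
apply: tpoly_sum => p; apply: tpolyZ; apply: tpolyD; apply: tpolyZ; exact: tpoly_cas.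
Qed.

Definition kmass N := Rint (fun t => Iper t * ker N t).

(** Invariance under [y] is read off from the expansion of [ker]: only frequency [0] survives
    integration over a period, and its term does not depend on [y]. *)
Lemma kmassE N y : 0 < b -> Rint (fun t => Iper t * ker N (y - t)) = kmass N.
Proof.
move=> b0; have [l kl] := tpoly_ker N.
have E y' : Rint (fun t => Iper t * ker N (y' - t)) =
    \sum_(p <- l) p.1 * (if p.2 == 0 then b^-1 else 0).
  under Rint_ext do rewrite kl mulr_sumr.
  have ic k : integ (fun t => Iper t * cos (frq k * t)) by exact/BM_integI/BM_cos_lin.
  have is_ k : integ (fun t => Iper t * sin (frq k * t)) by exact/BM_integI/BM_sin_lin.
  have E (p : R * int) t : Iper t * (p.1 * cas (frq p.2 * (y' - t))) =
     p.1 * cas (frq p.2 * y') * (Iper t * cos (frq p.2 * t)) +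
     (- p.1 * cas (frq (- p.2) * y')) * (Iper t * sin (frq p.2 * t)).
    by rewrite casB_lin; ring.
  under Rint_ext do under eq_bigr do rewrite E.
  rewrite Rint_sum => [|p]; last by apply: integD; exact: integZ.
  apply: eq_bigr => p _; rewrite RintD; [|exact: integZ..].
  rewrite !RintZ// Rint_cos_frq// Rint_sin_frq mulr0 addr0.
  case: eqP => [->|_]; last by rewrite !mulr0.
  by rewrite frq0 mul0r /cas cos0 sin0 addr0 mulr1.
rewrite E -(E 0) /kmass; apply: Rint_ext => t.
by rewrite sub0r kerN.
Qed.

End TrigSystem.

(** * Concentration of the kernel and pointwise convergence of the convolutions *)

Section Completeness.
Variables (R : realType) (b : R).
Local Notation I := (Iper b).
Local Notation ker := (ker b).
Local Notation kmass := (kmass b).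
Local Notation kconv := (kconv b).
Local Notation hper := (hper b).
Local Notation tri := (tri b).

Lemma cos_le_decr (x y : R) : 0 <= x -> x <= y -> y <= pi -> cos y <= cos x.
Proof.
move=> x0; rewrite le_eqVlt => /predU1P[->//|xy] ypi.
rewrite ltW// ltr_cos// in_itv/=; apply/andP; split; lra.
Qed.

Lemma cos_le_far (v w : R) : 0 <= v -> v <= w -> w <= 2 * pi - v -> cos w <= cos v.
Proof.
move=> v0 vw wv; case: (leP w pi) => wp; first exact: cos_le_decr.
have -> : cos w = cos (pi *+ 2 - w) by rewrite cosB cos2pi sin2pi mul0r addr0 mul1r.
by apply: cos_le_decr => //; rewrite -mulr_natl; lra.
Qed.

Lemma frq1_hper : 0 < b -> frq b 1 * hper = pi.
Proof. by move=> b0; rewrite /frq /hper; field; rewrite gt_eqF. Qed.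

Lemma frq1_gt0 : 0 < b -> 0 < frq b 1.
Proof. by move=> b0; rewrite /frq !mulr_gt0// pi_gt0. Qed.

Lemma cos_frq_abs (x : R) : cos (frq b 1 * x) = cos (frq b 1 * `|x|).
Proof. by case: (ger0P x) => // _; rewrite mulrN cosN. Qed.

Lemma ker_near N (x d : R) : 0 < b -> `|x| <= d -> d <= hper ->
  (1 + cos (frq b 1 * d)) ^+ N <= ker N x.
Proof.
move=> b0 xd dh; have f0 := frq1_gt0 b0; apply: lerXn2r; rewrite ?nnegrE.
- by rewrite -lerBlDl sub0r cos_geN1.
- by rewrite -lerBlDl sub0r cos_geN1.
rewrite lerD2l (cos_frq_abs x); apply: cos_le_decr.
- by rewrite mulr_ge0// ltW.
- by rewrite ler_pM2l.
- by rewrite -(frq1_hper b0) ler_pM2l.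
Qed.

(** The bound [2 * hper - d] keeps [x] away from the neighbouring peaks at distance [2 * hper] from
    [0]. *)
Lemma ker_far N (x d : R) : 0 < b -> 0 <= d -> d <= `|x| -> `|x| <= 2 * hper - d ->
  ker N x <= (1 + cos (frq b 1 * d)) ^+ N.
Proof.
move=> b0 d0 dx xh; have f0 := frq1_gt0 b0; apply: lerXn2r; rewrite ?nnegrE.
- by rewrite -lerBlDl sub0r cos_geN1.
- by rewrite -lerBlDl sub0r cos_geN1.
rewrite lerD2l (cos_frq_abs x); apply: cos_le_far.
- by rewrite mulr_ge0// ltW.
- by rewrite ler_pM2l.
- by rewrite -(frq1_hper b0) mulrCA -mulrBr ler_pM2l.
Qed.

Lemma integ_Iker N y : integ (fun t => I t * ker N (y - t)).
Proof. exact/BC_integ/BC_Iper_mul/BM_ker. Qed.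

Lemma integ_I : integ I.
Proof. exact/BC_integ/BC_Iper. Qed.

(** Only the part of the integral near the peak is kept. Used at half the radius of the tail bound
    [ker_far], it grows exponentially faster than the tail. *)
Lemma kmass_ge N (d : R) : 0 < b -> 0 < d -> d <= hper ->
  2 * d * (1 + cos (frq b 1 * d)) ^+ N <= kmass N.
Proof.
move=> b0 d0 dh; rewrite -(Rint_open_indic d0) mulrC -RintZ; last first.
  exact/BC_integ/BC_open_indic.
rewrite -(kmassE N 0 b0); apply: Rint_le.
- exact/integZ/BC_integ/BC_open_indic.
- exact: integ_Iker.
move=> t; rewrite open_indicE; case: ltP => td /=; last first.
  by rewrite mulr0 mulr_ge0 ?Iper_ge0 ?ker_ge0.
rewrite mulr1 Iper_in ?mul1r; last exact: lt_le_trans td dh.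
by rewrite sub0r kerN ker_near// ltW.
Qed.

Lemma cos_frq_gtN1 (d : R) : 0 < b -> 0 <= d -> d < hper -> 0 < 1 + cos (frq b 1 * d).
Proof.
move=> b0 d0 dh; have f0 := frq1_gt0 b0.
have p0 := @pi_gt0 R.
have dp : frq b 1 * d < pi by rewrite -(frq1_hper b0) ltr_pM2l.
have I1 : (pi : R) \in `[0, pi] by rewrite in_itv/= lexx (ltW p0).
have I2 : frq b 1 * d \in `[0, pi] by rewrite in_itv/= (mulr_ge0 (ltW f0) d0) (ltW dp).
have : cos pi < cos (frq b 1 * d) by rewrite ltr_cos.
by rewrite cospi; lra.
Qed.

Lemma kmass_gt0 N : 0 < b -> 0 < kmass N.
Proof.
move=> b0; have h0 := hper_gt0 b0.
have h2 : hper / 2 < hper by lra.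
apply: lt_le_trans (kmass_ge N b0 _ (ltW h2)); last lra.
by rewrite mulr_gt0 ?exprn_gt0 ?cos_frq_gtN1//; lra.
Qed.

Lemma kconv_bound f M N y : 0 < b -> BM f -> (forall x, `|f x| <= M) ->
  `|kconv f N y| <= M * kmass N.
Proof.
move=> b0 bf fM; rewrite -(kmassE N y b0) -RintZ; last exact: integ_Iker.
have fi : integ (fun t => I t * f t * ker N (y - t)).
  by apply: BC_integ; apply: BCM; [exact: BC_Iper_mul|exact: BM_ker].
apply: le_trans (Rint_norm fi) _; apply: Rint_le.
- exact: integ_norm.
- exact/integZ/integ_Iker.
move=> t; rewrite !normrM (ger0_norm (Iper_ge0 _ _)) (ger0_norm (ker_ge0 _ _ _)).
rewrite mulrCA -mulrA ler_wpM2l ?Iper_ge0// ler_wpM2r ?ker_ge0//.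
Qed.

Lemma kconv_cvg f y : 0 < b -> BM f -> {for y, continuous f} -> `|y| < hper ->
  kconv f N y / kmass N @[N --> \oo] --> f y.
Proof.
move=> b0 bf cf yh; have [mf [M fM]] := bf.
have M0 : 0 <= M by apply: le_trans (fM 0).
apply/cvgrPdist_le => e e0.
have e20 : 0 < e / 2 by lra.
move/cvgrPdist_le : cf => /(_ _ e20) /nbhs_ballP[d0 /= d00 dP].
(* [d < d0] serves continuity at [y]; [d < hper - |y|] ensures [|y - t| <= 2 * hper - d] for
   [|t| < hper], as [ker_far] requires. *)
pose d := Num.min (d0 / 2) ((hper - `|y|) / 2).
have dp : 0 < d by rewrite lt_min; apply/andP; split; lra.
have dd0 : d < d0 by rewrite gt_min; apply/orP; left; lra.
have dhy : d < hper - `|y| by rewrite gt_min; apply/orP; right; lra.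
have y0 := normr_ge0 y.
(* [a ^+ N] bounds the kernel from distance [d] on, [a' ^+ N] bounds it from below within [d / 2];
   as [a < a'], the tail becomes negligible against the mass. *)
pose a := 1 + cos (frq b 1 * d).
pose a' := 1 + cos (frq b 1 * (d / 2)).
have a0 : 0 < a by apply: cos_frq_gtN1 => //; lra.
have f0 := frq1_gt0 b0.
have aa' : a < a'.
  have I1 : frq b 1 * d \in `[0, pi].
    rewrite in_itv/= (mulr_ge0 (ltW f0) (ltW dp))/= -(frq1_hper b0) ler_pM2l//; lra.
  have I2 : frq b 1 * (d / 2) \in `[0, pi].
    have d20 : 0 <= d / 2 by lra.
    rewrite in_itv/= (mulr_ge0 (ltW f0) d20)/=.
    by rewrite -(frq1_hper b0) ler_pM2l//; lra.
  by rewrite ltrD2l ltr_cos// ltr_pM2l//; lra.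
have a'0 : 0 < a' by lra.
have cq : (a / a') ^+ n @[n --> \oo] --> (0 : R).
  by apply: cvg_expr; rewrite ger0_norm ?ltr_pdivrMr ?mul1r// divr_ge0// ltW.
(* This threshold for [(a / a') ^+ N] makes the far part [2 * M * a ^+ N / b] at most
   [e / 2 * kmass N]; the [+ 1] keeps the denominator positive when [M = 0]. *)
have C0 : 0 < e / 2 / (2 * M / (b * d) + 1).
  by rewrite divr_gt0// ltr_wpDl// divr_ge0 ?mulr_ge0// ltW.
have [N0 N0P] := cvg_to0P cq C0.
exists N0 => // N /= N0N.
have km := kmass_gt0 N b0.
have fi : integ (fun t => I t * f t * ker N (y - t)).
  by apply: BC_integ; apply: BCM; [exact: BC_Iper_mul|exact: BM_ker].
have -> : f y - kconv f N y / kmass N = (f y * kmass N - kconv f N y) / kmass N.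
  by field; rewrite gt_eqF.
rewrite normrM normfV (gtr0_norm km) ler_pdivrMr//.
rewrite -(kmassE N y b0) -RintZ; last exact: integ_Iker.
rewrite /kconv -RintB//; last exact/integZ/integ_Iker.
have di : integ (fun t => f y * (I t * ker N (y - t)) - I t * f t * ker N (y - t)).
  by apply: integB => //; exact/integZ/integ_Iker.
apply: le_trans (Rint_norm di) _.
have : Rint (fun t => `|f y * (I t * ker N (y - t)) - I t * f t * ker N (y - t)|) <=
       Rint (fun t => (e / 2) * (I t * ker N (y - t)) + (2 * M * a ^+ N) * I t).
  apply: Rint_le.
  - exact: integ_norm.
  - by apply: integD; apply: integZ; [exact: integ_Iker|exact: integ_I].
  move=> t.
  have -> : f y * (I t * ker N (y - t)) - I t * f t * ker N (y - t) =
     (f y - f t) * (I t * ker N (y - t)) by ring.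
  rewrite normrM (ger0_norm (mulr_ge0 (Iper_ge0 _ _) (ker_ge0 _ _ _))).
  have [yt|yt] := ltP (`|y - t|) d.
    have h : `|f y - f t| <= e / 2 by apply: dP; exact: lt_trans yt dd0.
    apply: le_trans (_ : (e / 2) * (I t * ker N (y - t)) <= _).
      by rewrite ler_wpM2r// mulr_ge0 ?Iper_ge0 ?ker_ge0.
    by rewrite lerDl mulr_ge0 ?Iper_ge0// mulr_ge0 ?mulr_ge0// exprn_ge0// ltW.
  have [th|th] := ltP `|t| hper; last first.
    by rewrite Iper_out// !(mul0r, mulr0) addr0.
  have h : `|f y - f t| <= 2 * M.
    by rewrite (le_trans (ler_normB _ _))// mulr_natl mulr2n lerD.
  rewrite Iper_in// !mul1r mulr1.
  apply: le_trans (_ : 2 * M * a ^+ N <= _); last first.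
    by rewrite lerDr mulr_ge0 ?ker_ge0// ltW.
  apply: ler_pM => //; first exact: ker_ge0.
  apply: ker_far => //; first exact: ltW.
  by have := ler_normB y t; lra.
move=> /le_trans; apply.
rewrite RintD; [|exact/integZ/integ_Iker|exact/integZ/integ_I].
rewrite !RintZ; [|exact: integ_I|exact: integ_Iker].
rewrite Rint_Iper// kmassE//.
have hk : d * a' ^+ N <= kmass N.
  have := @kmass_ge N (d / 2) b0; rewrite -/a'.
  have -> : 2 * (d / 2) = d by field.
  by apply; lra.
have := N0P N N0N; rewrite ger0_norm; last by rewrite exprn_ge0// divr_ge0// ltW.
rewrite ltr_pdivlMr; last by rewrite ltr_wpDl// divr_ge0 ?mulr_ge0// ltW.
set q := (a / a') ^+ N => hq.
have q0 : 0 <= q by rewrite exprn_ge0// divr_ge0// ltW.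
have aN : a ^+ N = q * a' ^+ N.
  by rewrite /q -exprMn divfK// gt_eqF.
rewrite aN.
have -> : 2 * M * (q * a' ^+ N) / b = (q * (2 * M / (b * d))) * (d * a' ^+ N).
  by field; rewrite !gt_eqF.
have h1 : q * (2 * M / (b * d)) <= e / 2 by lra.
have h2 : 0 <= d * a' ^+ N by rewrite mulr_ge0 ?exprn_ge0// ltW.
have : q * (2 * M / (b * d)) * (d * a' ^+ N) <= e / 2 * kmass N.
  by apply: ler_pM => //; rewrite mulr_ge0// divr_ge0 ?mulr_ge0// ltW.
lra.
Qed.

End Completeness.

(** * Completeness of the trigonometric system and Parseval on one period *)

Section Parseval.
Variables (R : realType) (b : R).
Local Notation I := (Iper b).
Local Notation kmass := (kmass b).
Local Notation kconv := (kconv b).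
Local Notation hper := (hper b).
Local Notation tri := (tri b).
Local Notation tpoly := (tpoly b).

Lemma BM_tpoly f : tpoly f -> BM f.
Proof.
move=> [l fl]; have -> : f = (fun x => \sum_(p <- l) p.1 * cas (frq b p.2 * x)).
  exact/funext.
elim: l {fl} => [|p l ih].
  by under [X in BM X]funext do rewrite big_nil; exact: BM_cst.
under [X in BM X]funext do rewrite big_cons.
by apply: BMD => //; apply: BMZ; exact: BM_cas_lin.
Qed.

(** The convolutions divided by [kmass] obey the bound of [f] and converge pointwise inside the
    period, so dominated convergence applies to the squared error. *)
Lemma tpoly_approx_continuous f e : 0 < b -> BM f -> continuous f -> 0 < e ->
  exists2 T, tpoly T & nrm (fun x => I x * f x - I x * T x) < e.
Proof.
move=> b0 bf cf e0; have [mf [M fM]] := bf.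
have M0 : 0 <= M by apply: le_trans (fM 0).
pose T n := fun x => (kmass n)^-1 * kconv f n x.
have tT n : tpoly (T n) by apply: tpolyZ; exact: tpoly_kconv.
have TM n x : `|T n x| <= M.
  rewrite normrM normfV (gtr0_norm (kmass_gt0 n b0)) mulrC ler_pdivrMr ?kmass_gt0//.
  exact: kconv_bound.
have bT n : BC (fun x => I x * f x - I x * T n x).
  by apply: BCB; apply: BC_Iper_mul => //; exact: BM_tpoly (tT n).
have [|||_ cv] := @Rint_dominated R (fun n x => (I x * f x - I x * T n x) ^+ 2)
    (fun=> 0) (fun x => (2 * M) ^+ 2 * I x) _ (integZ _ (integ_I b)).
- by move=> n; case: (BC_SQ (bT n)) => _ /integ_measurable.
- move=> x; case: (ltP `|x| hper) => xh; last first.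
    rewrite (_ : (fun n => _) = fun=> 0); first exact: cvg_cst.
    by apply/funext => n; rewrite Iper_out// !mul0r subr0 expr0n.
  rewrite (_ : (fun n => _) = fun n => (f x - T n x) * (f x - T n x)); last first.
    by apply/funext => n; rewrite Iper_in// !mul1r expr2.
  have h : T n x @[n --> \oo] --> f x.
    rewrite /T; under eq_fun do rewrite mulrC.
    by apply: kconv_cvg => //; exact: cf.
  have := cvgM (cvgB (cvg_cst (f x)) h) (cvgB (cvg_cst (f x)) h).
  by rewrite subrr mulr0 => H; apply: H; exact: _.
- move=> n x; rewrite normrX -mulrBr normrM (ger0_norm (Iper_ge0 _ _)) exprMn.
  rewrite expr2 Iper_idem mulrC ler_wpM2r ?Iper_ge0//.
  rewrite lerXn2r ?nnegrE ?mulr_ge0//.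
  by rewrite (le_trans (ler_normB _ _))// mulr_natl mulr2n lerD.
rewrite Rint_cst0 in cv.
have [N NP] := cvg_to0P cv e0.
exists (T N) => //; have := NP N (leqnn N).
by rewrite ger0_norm// nrm_ge0.
Qed.

Lemma tpoly_approx G e : 0 < b -> BC G -> (forall x, hper <= `|x| -> G x = 0) -> 0 < e ->
  exists2 T, tpoly T & nrm (fun x => G x - I x * T x) < e.
Proof.
move=> b0 bG G0 e0; have [[mG [M0 GM0]] _] := bG.
pose M := `|M0| + 1.
have Mp : 0 < M by rewrite ltr_wpDl.
have GM x : `|G x| <= M by rewrite (le_trans (GM0 x))// (le_trans (ler_norm _))// lerDl.
pose E : set R := `]- hper, hper[%classic.
have mE : measurable E by exact: measurable_itv.
have Ef : (@lebesgue_measure R E < +oo)%E.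
  by apply: le_lt_trans (le_refl (_ : \bar R)) _; rewrite /E lebesgue_measure_itv/=; case: ifPn => _; rewrite ?ltry// -EFinB ltry.
have Gi : (@lebesgue_measure R).-integrable E (EFin \o G).
  by apply: integrableS (BC_integ bG).
have [g [cg gi gc]] := @approximation_continuous_integrable R E G mE Ef Gi.
(* Budget: [2 * M] times this is [e / 8], and [nrmD_le] yields [2 * (e / 8) + 2 * (e / 4) < e]. *)
have e1 : 0 < e / (16 * M) by rewrite divr_gt0// mulr_gt0.
have : exists n, Rint (fun x => I x * `|G x - g n x|) < e / (16 * M).
  move/fine_cvgP : gc => [fg gc].
  have [N NP] := cvg_to0P gc e1.
  exists N; have := NP N (leqnn N).
  apply: le_lt_trans; rewrite Rint_indicM.
  by rewrite (le_trans (ler_norm _)).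
move=> [n gn].
(* Clipping to [[- M, M]] keeps continuity and, as [|G x| <= M], does not increase the distance to
   [G]. Boundedness then turns the [L^1] error into a squared [L^2] error at the cost of a factor
   [2 * M]. *)
pose g' x := Num.max (- M) (Num.min M (g n x)).
have cg' : continuous g'.
  move=> x.
  have h1 := @continuous_min _ _ (fun=> M : R^o) (g n : R -> R^o) x (@cst_continuous _ _ M x) (cg n x).
  exact: (@continuous_max _ _ (fun=> - M : R^o) _ x (@cst_continuous _ _ (- M) x) h1).
have g'M x : `|g' x| <= M.
  rewrite /g' ler_norml le_max lexx /= ge_max ge_min lexx /= andbT; lra.
have bg' : BM g' by split; [exact: continuous_measurable_fun|exists M].
have Gg x : `|G x - g' x| <= `|G x - g n x|.
  have := GM x; rewrite /g' ler_norml => /andP[h1 h2].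
  rewrite ler_norml; have := ler_norm (G x - g n x); have := ler_norm (g n x - G x).
  rewrite (distrC (g n x)) => h5 h6.
  by case: (leP M (g n x)) => h3; case: (leP (- M)) => h4;
    clear - Mp h1 h2 h3 h4 h5 h6; apply/andP; split; lra.
have [|T tT TP] := @tpoly_approx_continuous g' (e / 4) b0 bg' cg'; first lra.
exists T => //.
have GI x : G x = I x * G x.
  case: (ltP `|x| hper) => xh; first by rewrite Iper_in// mul1r.
  by rewrite G0// mulr0.
have bGI : BC (fun x => G x - I x * g' x) by apply: BCB => //; exact: BC_Iper_mul.
have s1 := BC_SQ bGI.
have s2 : SQ (fun x => I x * g' x - I x * T x).
  by apply/BC_SQ/BCB; apply: BC_Iper_mul => //; exact: BM_tpoly.
have := nrmD_le s1 s2.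
have -> : (fun x => G x - I x * g' x + (I x * g' x - I x * T x)) = (fun x => G x - I x * T x).
  by apply/funext => x; ring.
have : nrm (fun x => G x - I x * g' x) <= 2 * M * Rint (fun x => I x * `|G x - g n x|).
  have gni : integ (fun x => I x * `|G x - g n x|).
    have : (@lebesgue_measure R).-integrable E (fun x => `|G x - g n x|%:E).
      apply: integrable_norm => //.
      have : (@lebesgue_measure R).-integrable E ((EFin \o G) \- (EFin \o g n))%E.
        by apply: integrableB.
      by [].
    move=> H; have := (@integrable_mkcond _ (measurableTypeR R) R lebesgue_measure _ (fun x => `|G x - g n x|%:E) mE).1 H.
    rewrite /integ; congr (_.-integrable _ _).
    apply/funext => x /=; rewrite /Iper indicE patchE.
    by case: ifPn => _; rewrite ?mul1r ?mul0r.
  rewrite -RintZ//; apply: Rint_le.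
  - by case: s1.
  - exact: integZ.
  move=> x; rewrite {1}GI -mulrBr exprMn expr2 Iper_idem [leRHS]mulrCA ler_wpM2l ?Iper_ge0//.
  rewrite -real_normK ?num_real// expr2 ler_pM// ?Gg//.
  by rewrite (le_trans (ler_normB _ _))// mulr_natl mulr2n lerD.
have : 2 * M * Rint (fun x => I x * `|G x - g n x|) < e / 8.
  rewrite mulrC -ltr_pdivlMr ?mulr_gt0// (lt_le_trans gn)//.
  by rewrite le_eqVlt; apply/orP; left; apply/eqP; field; rewrite gt_eqF.
by move: TP; lra.
Qed.

(** Once [s] contains all frequencies of an approximant [T], the projection [P] is at least as close
    to [G] as [T] is, because [G - P] is orthogonal to [P - T]. *)
Lemma parseval_tri G e : 0 < b -> BC G -> (forall x, hper <= `|x| -> G x = 0) -> 0 < e ->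
  exists s0 : seq int, forall s, uniq s -> {subset s0 <= s} ->
    nrm G - b * \sum_(k <- s) ip G (tri k) ^+ 2 < e.
Proof.
move=> b0 bG G0 e0; have [T [l Tl] TP] := tpoly_approx b0 bG G0 e0.
exists [seq p.2 | p <- l] => s us sl.
have sG := BC_SQ bG.
have sP := SQ_projtri b s G.
have st := SQ_tri b.
rewrite -nrm_projtri//; apply: le_lt_trans TP.
have -> : (fun x => G x - I x * T x) = fun x => G x - \sum_(p <- l) p.1 * tri p.2 x.
  apply/funext => x; congr (_ - _).
  by rewrite Tl mulr_sumr; apply: eq_bigr => p _; rewrite mulrCA.
have sT : SQ (fun x => \sum_(p <- l) p.1 * tri p.2 x) by apply: SQ_sum => p; exact: SQZ.
have s1 : SQ (fun x => G x - projtri b s G x) by exact: SQB.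
have s2 := SQB sP sT.
have O k : k \in s -> ip (tri k) (fun x => G x - projtri b s G x) = 0.
  move=> ks; rewrite ipC ipBl// ip_sum_tri//.
  by field; rewrite gt_eqF.
have O2 : ip (fun x => G x - projtri b s G x)
   (fun x => projtri b s G x - \sum_(p <- l) p.1 * tri p.2 x) = 0.
  rewrite ipC ipBl// ip_suml//; last by move=> k; exact: SQZ.
  rewrite big_seq big1 => [|k ks]; last by rewrite ipZl// O// mulr0.
  rewrite ip_suml//; last by move=> k; exact: SQZ.
  rewrite big_seq big1 ?subr0// => p pl.
  by rewrite ipZl// O ?mulr0//; apply: sl; apply: map_f.
have -> : (fun x => G x - \sum_(p <- l) p.1 * tri p.2 x) =
   (fun x => (G x - projtri b s G x) + (projtri b s G x - \sum_(p <- l) p.1 * tri p.2 x)).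
  by apply/funext => x; ring.
by rewrite (nrmD s1 s2) O2 mulr0 addr0 lerDl nrm_ge0.
Qed.

End Parseval.

(** * The Hartley transform: measurability, self-adjointness and sampling *)

Section Hartley.
Variable R : realType.
Local Notation mu := (@lebesgue_measure R).
Implicit Types f g u : R -> R.

Definition Hart g : R -> R := fun x => Rint (fun y => g y * cas (2 * pi * x * y)).

Lemma BC_Hart_integrand g x : BC g -> BC (fun y => g y * cas (2 * pi * x * y)).
Proof. by move=> bg; apply: BCM => //; exact: BM_cas_lin. Qed.

Lemma integ_Hart g x : BC g -> integ (fun y => g y * cas (2 * pi * x * y)).
Proof. by move=> bg; exact/BC_integ/BC_Hart_integrand. Qed.

Lemma HartD g u : BC g -> BC u -> Hart (fun x => g x + u x) = fun x => Hart g x + Hart u x.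
Proof.
move=> bg bu; apply/funext => x; rewrite /Hart -RintD; [|exact: integ_Hart..].
by apply: Rint_ext => y; rewrite mulrDl.
Qed.

Lemma HartZ a g : BC g -> Hart (fun x => a * g x) = fun x => a * Hart g x.
Proof.
move=> bg; apply/funext => x; rewrite /Hart -RintZ; [|exact: integ_Hart].
by apply: Rint_ext => y; rewrite mulrA.
Qed.

Lemma HartB g u : BC g -> BC u -> Hart (fun x => g x - u x) = fun x => Hart g x - Hart u x.
Proof.
move=> bg bu; apply/funext => x; rewrite /Hart -RintB; [|exact: integ_Hart..].
by apply: Rint_ext => y; rewrite mulrBl.
Qed.

Lemma Hart_sum (I : Type) (s : seq I) (F : I -> R -> R) : (forall i, BC (F i)) ->
  Hart (fun x => \sum_(i <- s) F i x) = fun x => \sum_(i <- s) Hart (F i) x.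
Proof.
move=> bF; apply/funext => x; rewrite /Hart -Rint_sum => [|i]; last exact: integ_Hart.
by apply: Rint_ext => y; rewrite mulr_suml.
Qed.

Lemma Hart_bound g x : BC g -> `|Hart g x| <= Rint (fun y => 2 * `|g y|).
Proof.
move=> bg; apply: le_trans (Rint_norm (integ_Hart x bg)) _; apply: Rint_le.
- exact/integ_norm/integ_Hart.
- exact/integZ/integ_norm/BC_integ.
- by move=> y; rewrite normrM mulrC ler_wpM2r// cas_le2.
Qed.

Lemma measurable_cas_prod :
  measurable_fun [set: R * R] (fun z : R * R => cas (2 * pi * z.1 * z.2)).
Proof.
apply: measurableT_comp.
  by apply: continuous_measurable_fun; exact: continuous_cas.
by apply: measurable_funM => //; exact: measurable_funM.
Qed.

(** Adding [2 * |g|] makes the integrand nonnegative, so that measurability of partial integrals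
    follows from Tonelli; the added constant is then subtracted. *)
Lemma measurable_Hart g : BC g -> measurable_fun [set: R] (Hart g).
Proof.
move=> bg; have [[mg _] _] := bg.
pose k y := 2 * `|g y|.
have ki : integ k by exact/integZ/integ_norm/BC_integ.
pose F (z : R * R) := (k z.2 + g z.2 * cas (2 * pi * z.1 * z.2))%:E.
have mF : measurable_fun [set: R * R] F.
  apply/measurable_EFinP; apply: measurable_funD.
    by apply: measurable_funM => //; apply: measurableT_comp => //; exact: measurableT_comp.
  by apply: measurable_funM; [exact: measurableT_comp|exact: measurable_cas_prod].
have F0 z : (0 <= F z)%E.
  rewrite lee_fin /k -lerBlDl sub0r.
  have := ler_norm (- (g z.2 * cas (2 * pi * z.1 * z.2))).
  rewrite normrN normrM => h.
  have : `|g z.2| * `|cas (2 * pi * z.1 * z.2)| <= `|g z.2| * 2 by rewrite ler_wpM2l// cas_le2.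
  lra.
have := @measurable_fun_fubini_tonelli_F _ _ (measurableTypeR R) (measurableTypeR R) R mu F mF F0.
move=> mFF.
have -> : Hart g = fun x => fine (fubini_F mu F x) - Rint k.
  apply/funext => x; rewrite /fubini_F.
  have -> : fine (\int[mu]_y F (x, y))%E = Rint (fun y => k y + g y * cas (2 * pi * x * y)) by [].
  by rewrite (RintD ki (integ_Hart x bg)) addrAC subrr add0r.
apply: measurable_funB => //.
by apply: measurableT_comp => //; exact: measurable_fine.
Qed.

Lemma BM_Hart g : BC g -> BM (Hart g).
Proof.
move=> bg; split; first exact: measurable_Hart.
by eexists => x; exact: Hart_bound.
Qed.

(** Fubini, as the kernel is symmetric in its two arguments; integrability on the plane comes from
    the majorant [|u x| * (2 * |g y|)]. *)
Lemma Hart_sym g u : BC g -> BC u -> ip (Hart g) u = ip g (Hart u).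
Proof.
move=> bg bu; have [[mg _] _] := bg; have [[mu_ _] _] := bu.
pose F (z : R * R) := (u z.1 * (g z.2 * cas (2 * pi * z.1 * z.2)))%:E.
have mF : measurable_fun [set: R * R] F.
  apply/measurable_EFinP; apply: measurable_funM; first exact: measurableT_comp.
  by apply: measurable_funM; [exact: measurableT_comp|exact: measurable_cas_prod].
have iu : integ (fun x => `|u x| * Rint (fun y => 2 * `|g y|)).
  by under [X in integ X]funext do rewrite mulrC; exact/integZ/integ_norm/BC_integ.
have iF : (mu \x mu)%E.-integrable [set: R * R] F.
  have [_ ] := @integrable12ltyP _ _ (measurableTypeR R) (measurableTypeR R) R mu mu F mF.
  apply.
  apply: le_lt_trans (integrable_lty measurableT iu).
  apply: ge0_le_integral => //.
  - by move=> x _; apply: integral_ge0.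
  - have mA : measurable_fun [set: R * R] (abse \o F).
      by apply/measurable_EFinP; apply: measurableT_comp => //; exact/measurable_EFinP.
    exact: (@measurable_fun_fubini_tonelli_F _ _ (measurableTypeR R) (measurableTypeR R) R mu
      (abse \o F) mA (fun z => abse_ge0 _)).
  - by apply: measurable_int iu.
  move=> x _ /=.
  have i1 : integ (fun y => `|u x * (g y * cas (2 * pi * x * y))|).
    by apply: integ_norm; apply: integZ; exact: integ_Hart.
  rewrite -(EFin_Rint i1) lee_fin -RintZ; last exact/integZ/integ_norm/BC_integ.
  apply: Rint_le => //; first exact/integZ/integZ/integ_norm/BC_integ.
  move=> y; rewrite !normrM ler_wpM2l// mulrC ler_wpM2r// cas_le2//.
have := @Fubini _ _ (measurableTypeR R) (measurableTypeR R) R mu mu F iF.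
move=> /(congr1 fine) H; rewrite /ip.
transitivity (fine (\int[mu]_x \int[mu]_y F (x, y))%E).
  congr fine; apply: eq_integral => x _.
  have iy : integ (fun y => u x * (g y * cas (2 * pi * x * y))).
    by apply: integZ; exact: integ_Hart.
  apply: etrans (EFin_Rint iy).
  by rewrite (RintZ _ (integ_Hart x bg)) (mulrC (u x)).
rewrite H; congr fine; apply: eq_integral => y _.
have E : (fun x => u x * (g y * cas (2 * pi * x * y))) =
    (fun x => g y * (u x * cas (2 * pi * y * x))).
  by apply/funext => x; rewrite mulrCA (mulrAC _ x).
have ix : integ (fun x => u x * (g y * cas (2 * pi * x * y))).
  by rewrite E; apply: integZ; exact: integ_Hart.
apply: etrans (esym (EFin_Rint ix)) _.
by rewrite E (RintZ _ (integ_Hart y bu)).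
Qed.

(* Under [Hart], translation by [s] becomes [rotate s]. *)
Definition rotate s g : R -> R :=
  fun y => cos (2 * pi * s * y) * g y - sin (2 * pi * s * y) * g (- y).

Lemma BC_opp g : BC g -> BC (fun x => g (- x)).
Proof.
move=> bg; under [X in BC X]funext => x do rewrite -mulN1r.
by apply: BC_dil => //; rewrite oppr_eq0 oner_eq0.
Qed.

Lemma BMMC f g : BM f -> BC g -> BC (fun x => f x * g x).
Proof. by move=> bf bg; under [X in BC X]funext do rewrite mulrC; exact: BCM. Qed.

Lemma BC_rotate s g : BC g -> BC (rotate s g).
Proof.
move=> bg; apply: BCB; apply: BMMC => //.
- exact: BM_cos_lin.
- exact: BM_sin_lin.
- exact: BC_opp.
Qed.

(** Discards odd terms: the cross term in [nrm_rotate], the sine parts in [atom_Hart] and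
    [invFT_even]. *)
Lemma Rint_eqmod f g k : integ k -> (forall x, k (- x) = - k x) -> integ g ->
  (forall x, f x = g x + k x) -> Rint f = Rint g.
Proof. by move=> ik ko ig /Rint_ext ->; rewrite RintD// (Rint_odd ik ko) addr0. Qed.

(** The cross term of the square is odd in [y]. Reflecting the square that contains [g (- y)] leaves
    the factor [cos ^ 2 + sin ^ 2 = 1]. *)
Lemma nrm_rotate s g : BC g -> nrm (rotate s g) = nrm g.
Proof.
move=> bg; have bo := BC_opp bg.
set c := fun y => cos (2 * pi * s * y); set d := fun y => sin (2 * pi * s * y).
have bc : BM c by exact: BM_cos_lin.
have bd : BM d by exact: BM_sin_lin.
have cN x : c (- x) = c x by rewrite /c mulrN cosN.
have dN x : d (- x) = - d x by rewrite /d mulrN sinN.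
have i1 : integ (fun y => (c y * g y) ^+ 2) by case: (BC_SQ (BMMC bc bg)).
have i2 : integ (fun y => (d y * g y) ^+ 2) by case: (BC_SQ (BMMC bd bg)).
have i3 : integ (fun y => (d y * g (- y)) ^+ 2) by case: (BC_SQ (BMMC bd bo)).
have i4 : integ (fun y => c y * d y * (g y * g (- y))).
  by apply/BC_integ/BMMC; [exact: BMM|apply: BCM => //; case: bo].
rewrite /nrm (@Rint_eqmod _ (fun y => (c y * g y) ^+ 2 + (d y * g (- y)) ^+ 2)
  (fun y => - 2 * (c y * d y * (g y * g (- y))))).
- rewrite RintD//.
  have -> : Rint (fun y => (d y * g (- y)) ^+ 2) = Rint (fun y => (d y * g y) ^+ 2).
    rewrite -[RHS]Rint_opp//; apply: Rint_ext => y.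
    by rewrite dN mulNr sqrrN.
  rewrite -RintD//; apply: Rint_ext => y; rewrite !exprMn -mulrDl.
  by rewrite cos2Dsin2 mul1r.
- exact: integZ.
- by move=> x; rewrite cN dN opprK; ring.
- exact: integD.
- by move=> x; rewrite /rotate -/(c x) -/(d x); ring.
Qed.

(** Expand the shifted kernel by [casB] and reflect [y] in the second integral, which moves the sign
    from [cas] to [g]; the support condition allows the factor [Iper] to be inserted. Parseval thus
    evaluates the sum of squared samples on any shifted lattice. *)
Lemma Hart_shift b g k s : BC g -> (forall x, hper b <= `|x| -> g x = 0) ->
  Hart g (k%:~R * b + s) = ip (rotate s g) (tri b k).
Proof.
move=> bg g0; have bo := BC_opp bg.
set c := fun y => cos (2 * pi * s * y); set d := fun y => sin (2 * pi * s * y).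
have bc : BM c by exact: BM_cos_lin.
have bd : BM d by exact: BM_sin_lin.
have dN x : d (- x) = - d x by rewrite /d mulrN sinN.
have r0 x : rotate s g x * Iper b x = rotate s g x.
  case: (ltP `|x| (hper b)) => xh; first by rewrite Iper_in ?mulr1.
  by rewrite /rotate !g0 ?normrN// !mulr0 subrr mul0r.
have i1 : integ (fun y => c y * g y * cas (frq b k * y)).
  by apply: BC_integ; apply: BCM; [exact: BMMC|exact: BM_cas_lin].
have i2 : integ (fun y => d y * g (- y) * cas (frq b k * y)).
  by apply: BC_integ; apply: BCM; [exact: BMMC|exact: BM_cas_lin].
have i3 : integ (fun y => d (- y) * g y * cas (frq b k * - y)).
  by have := integ_opp i2; under [X in integ X -> _]funext do rewrite opprK.
transitivity (Rint (fun y => c y * g y * cas (frq b k * y) - d (- y) * g y * cas (frq b k * - y))).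
  apply: Rint_ext => y.
  have -> : 2 * pi * (k%:~R * b + s) * y = frq b k * y - - (2 * pi * s * y).
    by rewrite /frq; ring.
  by rewrite casB cosN sinN dN mulrN /c /d; ring.
rewrite RintB//.
have := Rint_opp i2; under Rint_ext do rewrite opprK; move=> ->.
rewrite -RintB//; apply: Rint_ext => y.
by rewrite /tri mulrA r0 /rotate -/(c y) -/(d y) mulrBl.
Qed.

End Hartley.

(** * Plancherel on the line *)

Section Plancherel.
Variable R : realType.
Local Notation mu := (@lebesgue_measure R).
Implicit Types f g u : R -> R.

(** Monotone convergence in a form that also yields integrability of the limit; for [Hart g ^+ 2] no
    integrable majorant is known beforehand. *)
Lemma Rint_monotone (F : nat -> R -> R) f l :
  (forall n, integ (F n)) -> (forall n x, 0 <= F n x) ->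
  (forall x n m, (n <= m)%N -> F n x <= F m x) ->
  (forall x, F n x @[n --> \oo] --> f x) -> Rint (F n) @[n --> \oo] --> l ->
  integ f /\ Rint f = l.
Proof.
move=> Fi F0 Fnd Ff Fl.
have mF n : measurable_fun [set: R] (F n) by exact: integ_measurable.
have mf : measurable_fun [set: R] f.
  by apply: (@measurable_fun_cvg _ _ _ _ F) => // x _; exact: Ff.
have fE x : (f x)%:E = limn (fun n => (F n x)%:E).
  apply/esym/cvg_lim => //; apply: cvg_EFin; last exact: Ff.
  by apply: nearW => n.
have f0 x : 0 <= f x.
  rewrite -(cvg_lim (@Rhausdorff R) (Ff x)); apply: limr_ge.
    by apply/cvg_ex; exists (f x); exact: Ff.
  by apply: nearW => n; exact: F0.
have := @cvg_monotone_convergence _ (measurableTypeR R) R mu setT measurableT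
  (fun n x => (F n x)%:E).
have -> : (\int[mu]_x limn ((fun n x => (F n x)%:E)^~ x) = \int[mu]_x (f x)%:E)%E.
  by apply: eq_integral => x _; rewrite fE.
move=> H.
have {}H : (\int[mu]_x (F n x)%:E)%E @[n --> \oo] --> (\int[mu]_x (f x)%:E)%E.
  apply: H.
  - by move=> n; apply/measurable_EFinP; exact: mF.
  - by move=> n x _; rewrite lee_fin.
  - by move=> x _ n m nm; rewrite lee_fin Fnd.
have H2 : (\int[mu]_x (F n x)%:E)%E @[n --> \oo] --> l%:E.
  have -> : (fun n => \int[mu]_x (F n x)%:E)%E = fun n => (Rint (F n))%:E.
    by apply/funext => n; rewrite EFin_Rint.
  by apply: cvg_EFin => //; apply: nearW => n.
have E : (\int[mu]_x (f x)%:E)%E = l%:E by exact: cvg_unique H H2.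
split; last by rewrite /Rint /Rintegral E.
apply/integrableP; split; first by apply/measurable_EFinP; exact: mf.
have -> : (\int[mu]_x `|(EFin \o f) x|)%E = (\int[mu]_x (f x)%:E)%E.
  by apply: eq_integral => x _ /=; rewrite ger0_norm.
by rewrite E ltry.
Qed.

Definition stp (a x : R) : R := ((a <= x)%R)%:R.

Lemma BM_stp a : BM (stp a).
Proof.
have -> : stp a = \1_(`[a, +oo[).
  apply/funext => x; rewrite /stp indicE; congr (nat_of_bool _)%:R.
  by apply/idP/idP; rewrite ?inE /= in_itv/= andbT.
exact: BM_indic.
Qed.

(** A difference of steps, so that consecutive cells telescope in [Rint_cells]; for [a <= b] it is
    the indicator of [[a, b[]. *)
Definition cell (a b x : R) : R := stp a x - stp b x.

Lemma cellE a b x : a <= b -> cell a b x = ((a <= x < b)%R)%:R.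
Proof.
move=> ab; rewrite /cell /stp; case: (leP b x) => bx.
  by rewrite (le_trans ab bx) subrr andbF.
by rewrite subr0 andbT.
Qed.

Lemma BC_cell a b : a <= b -> BC (cell a b).
Proof.
move=> ab; split.
  rewrite /cell; under [X in BM X]funext do rewrite -mulN1r.
  by apply: BMD; [exact: BM_stp|apply: BMZ; exact: BM_stp].
exists (Num.max `|a| `|b|) => x; rewrite gt_max => /andP[xa xb].
rewrite cellE//; case: andP => // -[ax bx]; exfalso.
have := ler_norm (- a); have := ler_norm b; rewrite normrN.
by move: xa xb; case: (ger0P x) => x0; lra.
Qed.

Lemma Rint_cell a b : a <= b -> Rint (cell a b) = b - a.
Proof.
move=> ab; have -> : cell a b = fun x => \1_(`[a, b[) x * 1.
  apply/funext => x; rewrite cellE// indicE mulr1; congr (nat_of_bool _)%:R.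
  by apply/idP/idP; rewrite ?inE /= in_itv/=.
rewrite Rint_indicM Rintegral_cst// mul1r.
apply: etrans (congr1 fine (lebesgue_measure_itv `[a, b[)) _ => /=.
rewrite lte_fin; case: ltP => //= ba; apply/esym/eqP; rewrite subr_eq0.
by rewrite eq_le ab ba.
Qed.

Definition zrange (N : nat) : seq int := [seq i%:Z - N%:Z | i <- index_iota 0 N.*2].

Lemma zrange_uniq N : uniq (zrange N).
Proof.
rewrite map_inj_uniq ?iota_uniq// => i j /(congr1 (fun z => z + N%:Z)).
by rewrite !subrK => -[].
Qed.

Lemma mem_zrange N k : (k \in zrange N) = (- N%:Z <= k < N%:Z).
Proof.
apply/mapP/idP => [[i]|/andP[h1 h2]].
  by rewrite mem_index_iota => /andP[_ iN] ->; lia.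
exists `|(k + N%:Z)%R|%N; last by lia.
by rewrite mem_index_iota; lia.
Qed.

Lemma zrange_sup (s : seq int) : exists N0, forall N, (N0 <= N)%N -> {subset s <= zrange N}.
Proof.
elim: s => [|k s [N0 h]]; first by exists 0%N.
exists (maxn N0 `|k|.+1) => N; rewrite geq_max => /andP[h1 h2] j.
rewrite inE => /orP[/eqP ->|]; last exact: h.
by rewrite mem_zrange; lia.
Qed.

(** The interval is cut into [2 N] cells of length [b], each of which is translated to [[0, b[]. *)
Lemma Rint_cells f b N : 0 <= b -> BM f ->
  Rint (fun x => f x * cell (- (N%:R * b)) (N%:R * b) x) =
  Rint (fun s => (\sum_(k <- zrange N) f (k%:~R * b + s)) * cell 0 b s).
Proof.
move=> b0 bf.
pose a (i : nat) := (i%:R - N%:R) * b.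
have aS i : a i.+1 = a i + b by rewrite /a -natr1; ring.
have cE x : f x * cell (- (N%:R * b)) (N%:R * b) x =
    \sum_(0 <= i < N.*2) f x * cell (a i) (a i + b) x.
  rewrite -mulr_sumr; congr (_ * _).
  transitivity (\sum_(0 <= i < N.*2) (- stp (a i.+1) x - - stp (a i) x)).
    rewrite telescope_sumr// opprK /cell addrC; congr (- stp _ _ + stp _ _).
      by rewrite /a -mul2n natrM; ring.
    by rewrite /a sub0r mulNr.
  by apply: eq_bigr => i _; rewrite opprK addrC aS.
under Rint_ext do rewrite cE.
have bc i : BC (cell (a i) (a i + b)) by apply: BC_cell; lra.
have bb i : BC (fun x => f x * cell (a i) (a i + b) x) by exact: BMMC.
rewrite Rint_sum => [|i]; last exact: BC_integ.
under [RHS]Rint_ext do rewrite big_map mulr_suml.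
have cs i s : cell (a i) (a i + b) (s + a i) = cell 0 b s.
  by rewrite /cell /stp lerDr (addrC s) lerD2l.
have E i s : f ((i%:Z - N%:Z)%:~R * b + s) * cell 0 b s =
   f (1 * s + a i) * cell (a i) (a i + b) (1 * s + a i).
  by rewrite mul1r cs rmorphB /= (addrC s).
under [RHS]Rint_ext do under eq_bigr do rewrite E.
rewrite Rint_sum => [|i].
  apply: eq_bigr => i _; rewrite (@Rint_affine _ 1 (a i)) ?oner_eq0//.
    by rewrite normr1 mul1r.
  exact: BC_integ.
by have := @integ_affine _ 1 (a i) _ (oner_neq0 _) (BC_integ (bb i)).
Qed.

Lemma parseval_shift g b s : 0 < b -> BC g -> (forall x, hper b <= `|x| -> g x = 0) ->
  (\sum_(k <- zrange N) Hart g (k%:~R * b + s) ^+ 2) @[N --> \oo] --> nrm g / b.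
Proof.
move=> b0 bg g0; have br := BC_rotate s bg.
have r0 x : hper b <= `|x| -> rotate s g x = 0.
  by move=> xh; rewrite /rotate !g0 ?normrN// !mulr0 subrr.
apply/cvgrPdist_lt => e e0.
have eb : 0 < e * b by rewrite mulr_gt0.
have [s0 sP] := parseval_tri b0 br r0 eb.
have [N0 NP] := zrange_sup s0.
exists N0 => // N /= N0N.
under eq_bigr do rewrite Hart_shift//.
have h1 := sP _ (zrange_uniq N) (NP N N0N).
have h2 := bessel_tri b0 (zrange_uniq N) (BC_SQ br).
rewrite nrm_rotate// in h1 h2.
set S := \sum_(_ <- _) _ in h1 h2 *.
have -> : nrm g / b - S = (nrm g - b * S) / b by field; rewrite gt_eqF.
by rewrite ger0_norm ?divr_ge0 ?subr_ge0// ?ltW// ltr_pdivrMr.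
Qed.

Lemma parseval_shift_le g b s N : 0 < b -> BC g -> (forall x, hper b <= `|x| -> g x = 0) ->
  \sum_(k <- zrange N) Hart g (k%:~R * b + s) ^+ 2 <= nrm g / b.
Proof.
move=> b0 bg g0; have br := BC_rotate s bg.
under eq_bigr do rewrite Hart_shift//.
have h2 := bessel_tri b0 (zrange_uniq N) (BC_SQ br).
rewrite nrm_rotate// in h2.
by rewrite ler_pdivlMr// mulrC.
Qed.

Lemma plancherel g : BC g -> SQ (Hart g) /\ nrm (Hart g) = nrm g.
Proof.
move=> bg; have [_ [r gr]] := bg.
(* Any [b] whose half-period exceeds [r] would serve; sampling is only a tool here and this [b] is
   unrelated to the wavelet lattice. *)
pose b : R := (2 * (`|r| + 1))^-1.
have b0 : 0 < b by rewrite invr_gt0 mulr_gt0// ltr_wpDl.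
have hE : hper b = `|r| + 1.
  by rewrite /hper /b; field; rewrite gt_eqF// ltr_wpDl.
have g0 x : hper b <= `|x| -> g x = 0.
  by rewrite hE => h; apply: gr; have := ler_norm r; lra.
pose f x := Hart g x ^+ 2.
have bH := BM_Hart bg.
have bf : BM f by under [X in BM X]funext do rewrite /f expr2; exact: BMM.
pose F (N : nat) x := f x * cell (- (N%:R * b)) (N%:R * b) x.
have Nb N : - (N%:R * b) <= N%:R * b.
  by have : 0 <= N%:R * b by [rewrite mulr_ge0// ltW]; lra.
have f0 x : 0 <= f x by exact: sqr_ge0.
suff : integ f /\ Rint f = nrm g.
  by move=> [fi fE]; split => //; split => //; case: bH.
apply: (@Rint_monotone F).
- by move=> N; apply/BC_integ/BMMC => //; exact: BC_cell.
- by move=> N x; rewrite mulr_ge0// cellE.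
- move=> x N M NM; rewrite ler_wpM2l// !cellE// ler_nat.
  have : N%:R * b <= M%:R * b by rewrite ler_wpM2r ?ler_nat// ltW.
  case: (boolP (_ <= x < _)) => // /andP[h1 h2] h3.
  suff -> : - (M%:R * b) <= x < M%:R * b by [].
  by apply/andP; split; lra.
- move=> x; apply: cvg_near_cst.
  exists (Num.bound `|x / b|) => // N /= hN.
  have xN : `|x| < N%:R * b.
    rewrite -ltr_pdivrMr//.
    have -> : `|x| / b = `|x / b| by rewrite normrM normfV (gtr0_norm b0).
    by apply: lt_le_trans (archi_boundP (normr_ge0 _)) _; rewrite ler_nat.
  rewrite /F cellE//; move: xN; rewrite ltr_norml => /andP[h1 h2].
  by rewrite (ltW h1) h2 mulr1.
have -> : (fun N => Rint (F N)) =
   fun N => Rint (fun s => (\sum_(k <- zrange N) f (k%:~R * b + s)) * cell 0 b s).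
  by apply/funext => N; rewrite Rint_cells// ltW.
have c0 : BC (cell 0 b) by apply: BC_cell; exact: ltW.
have -> : nrm g = Rint (fun s => nrm g / b * cell 0 b s).
  rewrite RintZ; last exact: BC_integ.
  by rewrite Rint_cell ?ltW// subr0 divfK// gt_eqF.
have S0 N s : 0 <= \sum_(k <- zrange N) f (k%:~R * b + s) by apply: sumr_ge0.
(* The Bessel inequality for each shift supplies the constant majorant [nrm g / b] on [[0, b[]. *)
have [||||] // := @Rint_dominated R
   (fun N s => (\sum_(k <- zrange N) f (k%:~R * b + s)) * cell 0 b s)
   (fun s => nrm g / b * cell 0 b s) (fun s => nrm g / b * cell 0 b s).
- move=> N; apply: measurable_funM; last by case: c0 => -[].
  apply: measurable_sum => k.
  have := measurable_comp_affine 1 (k%:~R * b) (proj1 bf).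
  by under [X in measurable_fun _ X -> _]funext do rewrite mul1r addrC.
- exact/integZ/BC_integ.
- by move=> s; apply: cvgMl; exact: parseval_shift.
- move=> N s; rewrite (cellE _ (ltW b0)) normrM normr_nat ler_wpM2r//.
  by rewrite ger0_norm// parseval_shift_le.
Qed.

Lemma SQ_Hart g : BC g -> SQ (Hart g). Proof. by move=> /plancherel[]. Qed.

Lemma nrm_Hart g : BC g -> nrm (Hart g) = nrm g. Proof. by move=> /plancherel[]. Qed.

Lemma ip_Hart g u : BC g -> BC u -> ip (Hart g) (Hart u) = ip g u.
Proof.
move=> bg bu; have := nrm_Hart (BCD bg bu).
have sg := SQ_Hart bg; have su := SQ_Hart bu.
rewrite HartD// (nrmD sg su) (nrmD (BC_SQ bg) (BC_SQ bu)) !nrm_Hart//; lra.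
Qed.

End Plancherel.

(** * Density of transforms of functions supported in annuli *)

Section Density.
Variable R : realType.
Implicit Types f g u : R -> R.

Lemma closed_indicE (r x : R) : \1_(`[- r, r]) x = ((`|x| <= r)%R)%:R :> R.
Proof.
rewrite indicE; congr (nat_of_bool _)%:R.
by apply/idP/idP; rewrite ?inE /= in_itv/= ler_norml.
Qed.

Lemma le_bound_near (x : R) : \forall n \near \oo, `|x| <= n%:R.
Proof.
exists (Num.bound `|x|) => // n /= hn.
by apply: le_trans (ltW (archi_boundP (normr_ge0 _))) _; rewrite ler_nat.
Qed.

(** Truncation in the argument and in the value, both at [N]. *)
Lemma BC_dense f e : SQ f -> 0 < e -> exists2 u, BC u & nrm (fun x => f x - u x) < e.
Proof.
move=> sf e0; have [mf f2] := sf.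
pose ind (N : nat) : R -> R := \1_(`[- N%:R, N%:R]).
pose u N x := ind N x * (f x * ind N (f x)).
have bu N : BC (u N).
  apply: BCM; first exact: BC_indic.
  have mi : measurable_fun [set: R] (ind N) by exact: measurable_indic.
  split; first by apply: measurable_funM => //; exact: measurableT_comp.
  exists N%:R => x; rewrite /ind closed_indicE.
  case: (boolP (`|f x| <= N%:R)) => h; first by rewrite mulr1.
  by rewrite mulr0 normr0.
have cv : nrm (fun x => f x - u n x) @[n --> \oo] --> (0 : R).
  have [||||_] := @Rint_dominated R (fun n x => (f x - u n x) ^+ 2) (fun=> 0)
    (fun x => f x ^+ 2).
  - by move=> n; case: (SQB sf (BC_SQ (bu n))) => _ /integ_measurable.
  - exact: f2.
  - move=> x; apply: cvg_near_cst; near=> n.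
    have h1 : `|x| <= n%:R by near: n; exact: le_bound_near.
    have h2 : `|f x| <= n%:R by near: n; exact: le_bound_near.
    by rewrite /u /ind !closed_indicE h1 h2 mulr1 mul1r subrr expr0n.
  - move=> n x; rewrite ger0_norm ?sqr_ge0// /u /ind !closed_indicE.
    case: (`|x| <= n%:R) => /=; case: (`|f x| <= n%:R) => /=;
      by rewrite ?(mulr0, mul0r, mulr1, mul1r, subr0, subrr, expr0n) ?sqr_ge0.
  by rewrite Rint_cst0.
have [N NP] := cvg_to0P cv e0.
exists (u N) => //; have := NP N (leqnn N).
by rewrite ger0_norm// nrm_ge0.
Unshelve. all: by end_near.
Qed.

Lemma Hart_dense f e : SQ f -> 0 < e ->
  exists g, [/\ BC g, exists2 d, 0 < d & forall y, `|y| < d -> g y = 0 &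
    nrm (fun x => f x - Hart g x) < e].
Proof.
move=> sf e0; have e4 : 0 < e / 4 by lra.
have [u bu fu] := BC_dense sf e4.
have bH := BM_Hart bu; have sH := SQ_Hart bu.
pose out (N : nat) : R -> R := \1_(`[- N%:R, N%:R]).
pose inn (N : nat) : R -> R := \1_(`]- N.+1%:R^-1, N.+1%:R^-1[).
pose A N x := out N x * (1 - inn N x).
have bA N : BC (A N).
  apply: BCM; first exact: BC_indic.
  under [X in BM X]funext do rewrite -mulN1r.
  by apply: BMD; [exact: BM_cst|apply: BMZ; exact: BM_indic].
have AE N x : A N x = ((`|x| <= N%:R) && (N.+1%:R^-1 <= `|x|))%R%:R.
  rewrite /A /out /inn closed_indicE open_indicE (leNgt N.+1%:R^-1).
  by case: (`|x| <= N%:R); case: (`|x| < _); rewrite /= ?(mulr1n, mulr0n, mul0r, mulr1, subrr, subr0, mulr0).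
pose g N x := Hart u x * A N x.
have bg N : BC (g N) by exact: BMMC.
(* Self-adjointness turns the cross term into [ip (Hart u) (g N) = nrm (g N)], so the error is
   exactly the energy of [Hart u] outside the annulus. *)
have nE N : nrm (fun x => u x - Hart (g N) x) = Rint (fun x => Hart u x ^+ 2 * (1 - A N x)).
  have su := BC_SQ bu; have sg := BC_SQ (bg N); have sHg := SQ_Hart (bg N).
  rewrite (nrmB su sHg) nrm_Hart// -Hart_sym//.
  have -> : ip (Hart u) (g N) = nrm (g N).
    apply: Rint_ext => x; rewrite /g exprMn expr2 mulrA AE.
    by case: (_ && _); rewrite ?mulr0 ?mulr1 ?expr0n ?expr1n ?mulr0 ?mulr1.
  rewrite -(nrm_Hart bu).
  have -> : nrm (Hart u) - 2 * nrm (g N) + nrm (g N) = nrm (Hart u) - nrm (g N) by ring.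
  rewrite -RintB; [|by case: sH|by case: sg].
  apply: Rint_ext => x; rewrite /g exprMn AE.
  by case: (_ && _); rewrite ?expr0n ?expr1n ?subrr ?mulr0 ?mulr1 ?subr0 ?subrr ?mulr1.
have cv : nrm (fun x => u x - Hart (g n) x) @[n --> \oo] --> (0 : R).
  under eq_fun do rewrite nE.
  (* The annuli exhaust everything but [0], where the integrand stays at [Hart u 0 ^+ 2]; the limit
     is therefore supported at one point and has integral zero. *)
  have [||||_] := @Rint_dominated R (fun n x => Hart u x ^+ 2 * (1 - A n x))
    (fun x => \1_([set 0]) x * Hart u x ^+ 2) (fun x => Hart u x ^+ 2).
  - move=> n; apply: measurable_funM; first by case: sH => _ /integ_measurable.
    by apply: measurable_funB => //; case: (bA n) => -[].
  - by case: sH.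
  - move=> x; case: (eqVneq x 0) => [->|x0].
      rewrite (_ : (fun n => _) = fun=> Hart u 0 ^+ 2).
        by rewrite indicE mem_set// mul1r; exact: cvg_cst.
      apply/funext => n; rewrite AE normr0 [X in _ && X]leNgt invr_gt0 ltr0n /= andbF.
      by rewrite subr0 mulr1.
    rewrite indicE memNset ?mul0r; last by apply/eqP.
    apply: cvg_near_cst; near=> n.
    have h1 : `|x| <= n%:R by near: n; exact: le_bound_near.
    have h2 : `|x^-1| <= n%:R by near: n; exact: le_bound_near.
    rewrite AE h1 /=.
    have -> : n.+1%:R^-1 <= `|x|.
      rewrite -[leRHS]invrK -normfV lef_pV2 ?posrE ?ltr0n ?normr_gt0 ?invr_eq0//.
      by rewrite (le_trans h2)// ler_nat.
    by rewrite subrr mulr0.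
  - move=> n x; rewrite normrM (ger0_norm (sqr_ge0 _)) ler_piMr ?sqr_ge0// AE.
    by case: (_ && _); rewrite ?subrr ?subr0 ?normr0 ?normr1.
  by rewrite Rint_indicM Rintegral_set1.
have [N NP] := cvg_to0P cv e4.
exists (g N); split => //.
  exists N.+1%:R^-1; first by rewrite invr_gt0 ltr0n.
  by move=> y hy; rewrite /g AE [X in _ && X]leNgt hy andbF mulr0.
have := NP N (leqnn N); rewrite ger0_norm ?nrm_ge0// => h.
have s1 := SQB sf (BC_SQ bu); have s2 := SQB (BC_SQ bu) (SQ_Hart (bg N)).
have := nrmD_le s1 s2.
have -> : (fun x => f x - u x + (u x - Hart (g N) x)) = (fun x => f x - Hart (g N) x).
  by apply/funext => x; ring.
by move/le_lt_trans; apply; lra.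
Unshelve. all: by end_near.
Qed.

End Density.

(** * Synthesis bounds, Bessel bounds and passage to the closure *)

Section AbstractFrames.
Variables (R : realType) (I : eqType).
Implicit Types (e et : I -> R -> R) (f g : R -> R).

Definition synthesis_bound e (B : R) :=
  (forall i, SQ (e i)) /\ forall (s : seq I) (a : I -> R), uniq s ->
    nrm (fun x => \sum_(i <- s) a i * e i x) <= B * \sum_(i <- s) a i ^+ 2.

Definition rsum e et f (s : seq I) : R -> R :=
  fun x => \sum_(i <- s) ip f (et i) * e i x.

Lemma SQ_rsum e et f s : (forall i, SQ (e i)) -> SQ (rsum e et f s).
Proof. by move=> se; apply: SQ_sum => i; exact: SQZ. Qed.

(** The adjoint bound: Cauchy-Schwarz for [f] and its own frame sum gives
    [S ^+ 2 <= nrm f * (B * S)], and [S] cancels. *)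
Lemma synthesis_bessel e B f s : 0 <= B -> synthesis_bound e B -> uniq s -> SQ f ->
  \sum_(i <- s) ip f (e i) ^+ 2 <= B * nrm f.
Proof.
move=> B0 [se eB] us sf; set S := \sum_(i <- s) _.
have S0 : 0 <= S by apply: sumr_ge0 => i _; exact: sqr_ge0.
have sr := SQ_rsum e f s se.
have SE : ip f (rsum e e f s) = S.
  rewrite ipC ip_suml// => [|i]; last exact: SQZ.
  by apply: eq_bigr => i _; rewrite ipZl// (ipC (e i)) expr2.
have := cauchy_schwarz sf sr; rewrite SE => h1.
have h2 := eB s (fun i => ip f (e i)) us; rewrite -/S in h2.
have h3 : S ^+ 2 <= nrm f * (B * S).
  by apply: le_trans h1 _; rewrite ler_wpM2l ?nrm_ge0.
move: S0; rewrite le_eqVlt => /predU1P[<-|S0]; first by rewrite mulr_ge0// nrm_ge0.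
rewrite -(ler_pM2r S0) -expr2.
by have -> : B * nrm f * S = nrm f * (B * S) by ring.
Qed.

Definition rreconstructs e et f := forall eps : R, 0 < eps -> exists F0 : seq I,
  forall s, uniq s -> {subset F0 <= s} -> nrm (fun x => f x - rsum e et f s x) < eps.

Lemma reconstructs_dense e et B Bt (D : (R -> R) -> Prop) :
  0 <= B -> 0 <= Bt -> synthesis_bound e B -> synthesis_bound et Bt ->
  (forall g, D g -> SQ g) ->
  (forall f eps, SQ f -> 0 < eps -> exists2 g, D g & nrm (fun x => f x - g x) < eps) ->
  (forall g, D g -> rreconstructs e et g) ->
  forall f, SQ f -> rreconstructs e et f.
Proof.
move=> B0 Bt0 He Het DS Dd Dr f sf eps eps0.
have [se eB] := He; have [st tB] := Het.
(* With [r] the partial sum operator, [f - r f = (f - g) + (g - r g) - r (f - g)]; applying the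
   factor-two inequalities twice gives at most [C * nrm (f - g) + 4 * nrm (g - r g)]. *)
pose C := 4 + 2 * (B * Bt).
have C0 : 0 < C by rewrite /C ltr_wpDr// mulr_ge0// mulr_ge0.
have e1 : 0 < eps / (2 * C) by rewrite divr_gt0// mulr_gt0.
have [g Dg fg] := Dd f _ sf e1.
have e2 : 0 < eps / 8 by lra.
have [F0 FP] := Dr g Dg _ e2.
exists F0 => s us Fs.
have sg := DS _ Dg.
have sfg := SQB sf sg.
have srg := SQB sg (SQ_rsum et g s se).
have srfg := SQ_rsum et (fun x => f x - g x) s se.
have -> : (fun x => f x - rsum e et f s x) = (fun x =>
   ((f x - g x) + (g x - rsum e et g s x)) - rsum e et (fun x => f x - g x) s x).
  apply/funext => x.
  suff -> : rsum e et (fun x => f x - g x) s x = rsum e et f s x - rsum e et g s x by ring.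
  rewrite /rsum -sumrB; apply: eq_bigr => i _.
  by rewrite ipBl// mulrBl.
apply: le_lt_trans (nrmB_le (SQD sfg srg) srfg) _.
have h1 := nrmD_le sfg srg.
have h2 := FP s us Fs.
have h3 : nrm (rsum e et (fun x => f x - g x) s) <= B * (Bt * nrm (fun x => f x - g x)).
  apply: le_trans (eB _ _ us) _; rewrite ler_wpM2l//.
  exact: synthesis_bessel.
have h4 : (4 + 2 * (B * Bt)) * nrm (fun x => f x - g x) < eps / 2.
  rewrite -/C mulrC -ltr_pdivlMr//.
  by have -> : eps / 2 / C = eps / (2 * C) by field; rewrite gt_eqF.
move: h1 h2 h3 h4.
set X := nrm _; set Y := nrm _; set Z := nrm _; set V := nrm _.
rewrite !mulrA; lra.
Qed.

End AbstractFrames.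

(** * Finite sums: a weighted inequality and grouping by scale *)

Section FiniteSums.
Variable R : realType.

Lemma weighted_cauchy_schwarz (I : Type) (s : seq I) (w x : I -> R) :
  (forall i, 0 <= w i) ->
  (\sum_(i <- s) w i * x i) ^+ 2 <= (\sum_(i <- s) w i) * \sum_(i <- s) w i * x i ^+ 2.
Proof.
move=> w0; elim: s => [|i s ih]; first by rewrite !big_nil mul0r expr0n.
rewrite !big_cons.
(* Adding the index [i] increases the right side minus the left side by exactly [w i] times this
   sum. *)
have : 0 <= \sum_(j <- s) w j * (x j - x i) ^+ 2.
  by apply: sumr_ge0 => j _; rewrite mulr_ge0// sqr_ge0.
have -> : \sum_(j <- s) w j * (x j - x i) ^+ 2 = \sum_(j <- s) w j * x j ^+ 2
   - 2 * x i * (\sum_(j <- s) w j * x j) + x i ^+ 2 * \sum_(j <- s) w j.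
  by rewrite !mulr_sumr -sumrB -big_split /=; apply: eq_bigr => j _; ring.
move: ih; set A := \sum_(j <- s) w j; set B := \sum_(j <- s) w j * x j.
set C := \sum_(j <- s) _ => h1 h2.
have := w0 i => wi; have := mulr_ge0 wi h2; nra.
Qed.

(** [t] may omit first components on which [F] vanishes: in [atom_reconstructs] only the scales in
    [J] meet the support of [g]. *)
Lemma sum_fibers (J K : eqType) (s : seq (J * K)) (t : seq J) (F : J * K -> R) :
  uniq t -> (forall i, i \in s -> i.1 \notin t -> F i = 0) ->
  \sum_(i <- s) F i = \sum_(j <- t) \sum_(k <- [seq i.2 | i <- s & i.1 == j]) F (j, k).
Proof.
move=> ut F0.
have E j : \sum_(k <- [seq i.2 | i <- s & i.1 == j]) F (j, k) = \sum_(i <- s | i.1 == j) F i.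
  by rewrite big_map big_filter; apply: eq_bigr => -[a k] /= /eqP ->.
under [RHS]eq_bigr do rewrite E.
rewrite (exchange_big_dep predT)//= big_seq [RHS]big_seq; apply: eq_bigr => i si.
case: (boolP (i.1 \in t)) => it.
  rewrite (eq_bigl (fun j => j == i.1)) => [|j]; last by rewrite eq_sym.
  by rewrite -big_filter filter_pred1_uniq// big_seq1.
by rewrite F0//; apply/esym/big1_seq => j _.
Qed.

Lemma fiber_uniq (J K : eqType) (s : seq (J * K)) j : uniq s ->
  uniq [seq i.2 | i <- s & i.1 == j].
Proof.
move=> us; rewrite map_inj_in_uniq ?filter_uniq// => -[a1 a2] [b1 b2].
by rewrite !mem_filter /= => /andP[/eqP -> _] /andP[/eqP -> _] ->.
Qed.

Lemma mem_fiber (J K : eqType) (s : seq (J * K)) j k :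
  (k \in [seq i.2 | i <- s & i.1 == j]) = ((j, k) \in s).
Proof.
apply/mapP/idP => [[[a1 a2]]|jk].
  by rewrite mem_filter /= => /andP[/eqP -> h] ->.
by exists (j, k) => //; rewrite mem_filter eqxx.
Qed.

End FiniteSums.

(** * Frame estimates for dilated and modulated generators *)

Section WaveletFrames.
Variables (R : realType) (c b : R).
Implicit Types (H Ht g : R -> R) (i : int * int).
Local Notation I := (Iper b).

Lemma cexp_gt0 (j : int) : 0 < c -> 0 < c ^ j.
Proof. exact: exprz_gt0. Qed.

(** The Hartley side of [atom]: dilation by [c ^ j] turns into dilation by its inverse, translation
    by [k b] into multiplication by [cas]. *)
Definition atomhat H (i : int * int) : R -> R := fun y =>
  (Num.sqrt (c ^ i.1))^-1 * (H ((c ^ i.1)^-1 * y) * cas (frq b i.2 * ((c ^ i.1)^-1 * y))).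

Definition atom H (i : int * int) : R -> R := fun x =>
  Num.sqrt (c ^ i.1) * Hart H (c ^ i.1 * x - i.2%:~R * b).

Lemma BM_mul (a : R) f : BM f -> BM (fun x : R => f (a * x)).
Proof. by move=> /(BM_dil a 0); under [X in BM X -> _]funext do rewrite addr0. Qed.

Lemma BM_cas_mul (w a : R) : BM (fun x => cas (w * (a * x))).
Proof. by under [X in BM X]funext do rewrite mulrA; exact: BM_cas_lin. Qed.

Lemma BC_atomhat H i : 0 < c -> BC H -> BC (atomhat H i).
Proof.
move=> c0 bH; apply: BCZ; apply: BCM.
  by apply: BC_dil => //; rewrite invr_eq0 gt_eqF// cexp_gt0.
exact: BM_cas_mul.
Qed.

(** After rescaling, and since [H] is even, all sine integrals vanish; both sides reduce to the
    integral of [H y] against the cosine of [(2 pi a x - frq b k) * y]. *)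
Lemma atom_Hart H i : 0 < c -> BC H -> (forall y, H (- y) = H y) ->
  atom H i = Hart (atomhat H i).
Proof.
move=> c0 bH ev; apply/funext => x; case: i => j k.
have bh := BC_atomhat (j, k) c0 bH.
rewrite /atom [RHS]/Hart /=; have a0 := cexp_gt0 j c0.
set a := c ^ j in a0 *.
rewrite (Rint_dil (lt0r_neq0 a0) (integ_Hart x bh)) (gtr0_norm a0).
have E y : atomhat H (j, k) (a * y) * cas (2 * pi * x * (a * y)) =
   (Num.sqrt a)^-1 * (H y * (cas (frq b k * y) * cas (2 * pi * (a * x) * y))).
  rewrite /atomhat /= -/a mulKf ?gt_eqF// -!mulrA; congr (_ * (_ * (_ * cas _))).
  by ring.
under [in RHS]Rint_ext do rewrite E.
have mc : BM (fun y => cas (frq b k * y) * cas (2 * pi * (a * x) * y)).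
  by apply: BMM; exact: BM_cas_lin.
rewrite RintZ; last exact/BC_integ/BCM.
have sa : Num.sqrt a ^+ 2 = a by rewrite sqr_sqrtr// ltW.
have sa0 : Num.sqrt a != 0 by rewrite gt_eqF// sqrtr_gt0.
have -> : a * ((Num.sqrt a)^-1 * Rint (fun y => H y * (cas (frq b k * y) * cas (2 * pi * (a * x) * y))))
   = Num.sqrt a * Rint (fun y => H y * (cas (frq b k * y) * cas (2 * pi * (a * x) * y))).
  by rewrite -{1}sa; field.
congr (_ * _).
have d1 : frq b k = 2 * pi * (k%:~R * b) by [].
have ic : integ (fun y => H y * cos ((2 * pi * (a * x) - frq b k) * y)).
  by apply: BC_integ; apply: BCM => //; exact: BM_cos_lin.
have is_ w : integ (fun y => H y * sin (w * y)).
  by apply: BC_integ; apply: BCM => //; exact: BM_sin_lin.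
have os w y : H (- y) * sin (w * - y) = - (H y * sin (w * y)).
  by rewrite ev mulrN sinN mulrN.
rewrite /Hart.
rewrite (@Rint_eqmod _ _ _ _ (is_ (2 * pi * (a * x) - frq b k)) (os _) ic); last first.
  by move=> y; rewrite /cas d1 mulrDr; congr (_ * cos _ + _ * sin _); ring.
rewrite (@Rint_eqmod _ _ _ _ (is_ (2 * pi * (a * x) + frq b k)) (os _) ic)// => y.
by rewrite (mulrC (cas (frq b k * y))) casM -mulrBl -mulrDl mulrDr.
Qed.

(** The properties shared by both generators on which all frame estimates rest. *)
Definition admissible H (M W : R) := [/\ BC H, forall y, H (- y) = H y,
  forall y, 0 <= H y <= M, forall y, hper b <= `|y| -> H y = 0 &
  forall (J : seq int) y, uniq J -> \sum_(j <- J) H ((c ^ j)^-1 * y) <= W].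

(* Cauchy-Schwarz with the weights [H ((c ^ j)^-1 * y)], whose sum over [j] is at
   most [W]: no count of overlapping dilates is needed. *)
Lemma freq_bound H M W (J : seq int) (z : int -> R -> R) :
  0 < c -> 0 <= W -> admissible H M W -> uniq J -> (forall j, BM (z j)) ->
  nrm (fun y => \sum_(j <- J) H ((c ^ j)^-1 * y) * z j y) <=
  W * M * \sum_(j <- J) c ^ j * nrm (fun y => I y * z j (c ^ j * y)).
Proof.
move=> c0 W0 [bH ev HM H0 HW] uJ bz.
have cn j : (c ^ j)^-1 != 0 by rewrite invr_eq0 gt_eqF// cexp_gt0.
have bHj j : BC (fun y => H ((c ^ j)^-1 * y)) by exact: BC_dil.
have bI j : BC (fun y => I ((c ^ j)^-1 * y) * z j y ^+ 2).
  apply: BCM; first by apply: BC_dil => //; exact: BC_Iper.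
  by under [X in BM X]funext do rewrite expr2; exact: BMM.
have Ej j : Rint (fun y => I ((c ^ j)^-1 * y) * z j y ^+ 2) =
    c ^ j * nrm (fun y => I y * z j (c ^ j * y)).
  have a0 := cexp_gt0 j c0.
  rewrite (Rint_dil (lt0r_neq0 a0) (BC_integ (bI j))) (gtr0_norm a0); congr (_ * _).
  by apply: Rint_ext => y; rewrite mulKf ?gt_eqF// exprMn (expr2 (I y)) Iper_idem.
have -> : W * M * \sum_(j <- J) c ^ j * nrm (fun y => I y * z j (c ^ j * y)) =
   Rint (fun y => W * M * \sum_(j <- J) I ((c ^ j)^-1 * y) * z j y ^+ 2).
  rewrite RintZ; last by apply: integ_sum => j; exact: BC_integ.
  rewrite Rint_sum; last by move=> j; exact: BC_integ.
  by congr (_ * _); apply: eq_bigr => j _; rewrite Ej.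
apply: Rint_le.
- by case: (@BC_SQ R (fun y => \sum_(j <- J) H ((c ^ j)^-1 * y) * z j y)) => //;
    apply: BC_sum => j; exact: BCM.
- by apply: integZ; apply: integ_sum => j; exact: BC_integ.
move=> y; apply: le_trans (weighted_cauchy_schwarz _ _ _) _.
  by move=> j; case/andP: (HM ((c ^ j)^-1 * y)).
rewrite -mulrA; apply: ler_pM => //.
- by apply: sumr_ge0 => j _; case/andP: (HM ((c ^ j)^-1 * y)).
- by apply: sumr_ge0 => j _; rewrite mulr_ge0 ?sqr_ge0//; case/andP: (HM ((c ^ j)^-1 * y)).
- exact: HW.
(* One factor [H] is replaced by [M] times the indicator of the dilated period, so that each scale
   contributes a norm over a single period. *)
rewrite mulr_sumr; apply: ler_sum => j _; rewrite [leRHS]mulrA ler_wpM2r ?sqr_ge0//.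
case: (ltP `|(c ^ j)^-1 * y| (hper b)) => h.
  by rewrite Iper_in// mulr1; case/andP: (HM ((c ^ j)^-1 * y)).
by rewrite H0// Iper_out// mulr0.
Qed.

Lemma adm_ge0 H M W : admissible H M W -> 0 <= M.
Proof. by case=> _ _ /(_ 0) /andP[h1 h2] _ _; apply: le_trans h2. Qed.

Lemma adm_W_ge0 H M W : admissible H M W -> 0 <= W.
Proof. by case=> _ _ _ _ /(_ [::] 0 isT); rewrite big_nil. Qed.

(** At each scale the combination is [H] times a trigonometric polynomial, whose norm over a period
    is its sum of squared coefficients over [b]. The factor [c ^ j] from the dilation cancels the
    normalisation of the atoms. *)
Lemma atom_synthesis H M W : 0 < c -> 0 < b -> admissible H M W ->
  synthesis_bound (atom H) (W * M / b).
Proof.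
move=> c0 b0 aH; have [bH ev HM H0 HW] := aH.
have W0 := adm_W_ge0 aH.
have aE i : atom H i = Hart (atomhat H i) by exact: atom_Hart.
have bh i := BC_atomhat i c0 bH.
split => [i|s a us]; first by rewrite aE; exact: SQ_Hart.
have -> : (fun x => \sum_(i <- s) a i * atom H i x) =
    Hart (fun x => \sum_(i <- s) a i * atomhat H i x).
  rewrite Hart_sum => [|i]; last exact: BCZ.
  by apply/funext => x; apply: eq_bigr => i _; rewrite aE HartZ.
rewrite nrm_Hart; last by apply: BC_sum => i; exact: BCZ.
pose J := undup (map fst s).
have uJ : uniq J by exact: undup_uniq.
have sJ i : i \in s -> i.1 \in J by move=> si; rewrite mem_undup map_f.
pose sj j := [seq i.2 | i <- s & i.1 == j].
pose z j y := (Num.sqrt (c ^ j))^-1 * \sum_(k <- sj j) a (j, k) * cas (frq b k * ((c ^ j)^-1 * y)).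
have fib (F : int * int -> R) : \sum_(i <- s) F i = \sum_(j <- J) \sum_(k <- sj j) F (j, k).
  by apply: sum_fibers => // i si; rewrite sJ.
have -> : (fun x => \sum_(i <- s) a i * atomhat H i x) =
    (fun y => \sum_(j <- J) H ((c ^ j)^-1 * y) * z j y).
  apply/funext => y; rewrite fib; apply: eq_bigr => j _.
  by rewrite /z !mulr_sumr; apply: eq_bigr => k _; rewrite /atomhat /=; ring.
have bz j : BM (z j).
  apply: BMZ; elim: (sj j) => [|k t ih].
    by under [X in BM X]funext do rewrite big_nil; exact: BM_cst.
  under [X in BM X]funext do rewrite big_cons.
  by apply: BMD => //; apply: BMZ; exact: BM_cas_mul.
apply: le_trans (freq_bound c0 W0 aH uJ bz) _.
rewrite -!mulrA ler_wpM2l// ler_wpM2l ?(adm_ge0 aH)// fib mulr_sumr ler_sum// => j _.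
have a0 := cexp_gt0 j c0.
have -> : (fun y => I y * z j (c ^ j * y)) =
    (fun y => (Num.sqrt (c ^ j))^-1 * \sum_(k <- sj j) a (j, k) * tri b k y).
  apply/funext => y; rewrite /z mulrCA mulr_sumr; congr (_ * _); apply: eq_bigr => k _.
  by rewrite mulKf ?gt_eqF// /tri mulrCA.
have st := SQ_tri b.
rewrite nrmZ; last by apply: SQ_sum => k; exact: SQZ.
rewrite (nrm_sum_tri (fun k => a (j, k)))//; last exact: fiber_uniq.
by rewrite exprVn (sqr_sqrtr (ltW a0)) mulVKf// gt_eqF.
Qed.

(** The identity assumed for [J] writes [g] as a sum of terms [H] times [g * Ht / b]. The error is
    thus a sum of [H] times the remainder of one trigonometric expansion per scale, and [freq_bound]
    controls it. *)
Lemma atom_reconstructs H Ht M W Mt Wt g d L : 0 < c -> 0 < b ->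
  admissible H M W -> admissible Ht Mt Wt ->
  BC g -> 0 < d -> (forall y, `|y| < d -> g y = 0) -> (forall y, L < `|y| -> g y = 0) ->
  (exists J : seq int, uniq J /\ (forall j y, j \notin J -> d <= `|y| <= L ->
     Ht ((c ^ j)^-1 * y) = 0) /\
    (forall y, d <= `|y| <= L ->
     \sum_(j <- J) H ((c ^ j)^-1 * y) * Ht ((c ^ j)^-1 * y) = b)) ->
  rreconstructs (atom H) (atom Ht) (Hart g).
Proof.
move=> c0 b0 aH aHt bg d0 gd gL [J [uJ [J0 JS]]] eps eps0.
have [bH ev HM H0 HW] := aH.
have [bHt evt HtM Ht0 HtW] := aHt.
have W0 := adm_W_ge0 aH; have M0 := adm_ge0 aH.
have bh i := BC_atomhat i c0 bH; have bht i := BC_atomhat i c0 bHt.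
have gsupp y : g y != 0 -> d <= `|y| <= L.
  move=> gy; apply/andP; split; rewrite leNgt; apply: contraNN gy => h; apply/eqP.
    exact: gd.
  exact: gL.
pose cf i := ip g (atomhat Ht i).
(* The part of [g] seen at scale [j], dilated back to the base period; by [cfE] its trigonometric
   coefficients are the wavelet coefficients up to normalisation. *)
pose G j y := g (c ^ j * y) * Ht y.
have cn j : c ^ j != 0 by rewrite gt_eqF// cexp_gt0.
have bG j : BC (G j) by apply: BCM; [exact: BC_dil|case: bHt].
have G0 j y : hper b <= `|y| -> G j y = 0 by move=> h; rewrite /G Ht0// mulr0.
have cfE j k : (Num.sqrt (c ^ j))^-1 * cf (j, k) = ip (G j) (tri b k).
  have a0 := cexp_gt0 j c0.
  rewrite /cf /ip (@Rint_dil _ (c ^ j))//; last by apply/BC_integ/BCM => //; case: (bht (j, k)).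
  rewrite (gtr0_norm a0).
  have E y : g (c ^ j * y) * atomhat Ht (j, k) (c ^ j * y) =
     (Num.sqrt (c ^ j))^-1 * (G j y * tri b k y).
    rewrite /atomhat /= mulKf//.
    have -> : G j y * tri b k y = G j y * cas (frq b k * y).
      rewrite /tri mulrA; case: (ltP `|y| (hper b)) => h; first by rewrite Iper_in// mulr1.
      by rewrite G0// !mul0r.
    by rewrite /G; ring.
  under Rint_ext do rewrite E.
  rewrite RintZ; last by apply/BC_integ/BCM => //; case: (BC_tri b k).
  have E2 (q r : R) : q != 0 -> q^-1 * (q ^+ 2 * (q^-1 * r)) = r by move=> q0; field.
  have q0 : Num.sqrt (c ^ j) != 0 by rewrite gt_eqF// sqrtr_gt0.
  by have := E2 _ (Rint (fun y => G j y * tri b k y)) q0; rewrite (sqr_sqrtr (ltW a0)).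
have cf0 i : i.1 \notin J -> cf i = 0.
  move=> iJ; rewrite /cf /ip -(Rint_cst0 R); apply: Rint_ext => y.
  case: (eqVneq (g y) 0) => [->|gy]; first by rewrite mul0r.
  by rewrite /atomhat J0 ?gsupp// mul0r !mulr0.
(* [W * M] comes from [freq_bound], [b ^+ 2] from the factor [b^-1] in [z], and the sum from the
   weights [c ^ j]; accuracy [eps / (K + 1)] at each scale then suffices. *)
pose K := W * M / b ^+ 2 * (\sum_(j <- J) c ^ j).
have S0 : 0 <= \sum_(j <- J) c ^ j by apply: sumr_ge0 => j _; exact/ltW/cexp_gt0.
have K0 : 0 <= K by apply: mulr_ge0 => //; apply: divr_ge0; [exact: mulr_ge0|exact: sqr_ge0].
have e1 : 0 < eps / (K + 1) by rewrite divr_gt0// ltr_wpDl.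
pose S j := projT1 (cid (parseval_tri b0 (bG j) (@G0 j) e1)).
have SP j : forall s, uniq s -> {subset S j <= s} ->
   nrm (G j) - b * \sum_(k <- s) ip (G j) (tri b k) ^+ 2 < eps / (K + 1).
  by rewrite /S; case: cid.
exists (flatten [seq [seq (j, k) | k <- S j] | j <- J]) => s us Fs.
pose sj j := [seq i.2 | i <- s & i.1 == j].
have usj j : uniq (sj j) by exact: fiber_uniq.
have Ssj j : j \in J -> {subset S j <= sj j}.
  move=> jJ k kS; rewrite mem_fiber; apply: Fs; apply/flattenP.
  by exists [seq (j, k) | k <- S j]; [exact: map_f|exact: map_f].
have ipE i : ip (Hart g) (atom Ht i) = cf i by rewrite atom_Hart// ip_Hart.
have -> : (fun x => Hart g x - rsum (atom H) (atom Ht) (Hart g) s x) =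
    Hart (fun y => g y - \sum_(i <- s) cf i * atomhat H i y).
  rewrite HartB//; last by apply: BC_sum => i; exact: BCZ.
  rewrite Hart_sum => [|i]; last exact: BCZ.
  apply/funext => x; congr (_ - _); apply: eq_bigr => i _.
  by rewrite ipE HartZ// atom_Hart.
rewrite nrm_Hart; last by apply: BCB => //; apply: BC_sum => i; exact: BCZ.
pose z j y := b^-1 * (g y * Ht ((c ^ j)^-1 * y)) -
  \sum_(k <- sj j) (Num.sqrt (c ^ j))^-1 * cf (j, k) * cas (frq b k * ((c ^ j)^-1 * y)).
have -> : (fun y => g y - \sum_(i <- s) cf i * atomhat H i y) =
    (fun y => \sum_(j <- J) H ((c ^ j)^-1 * y) * z j y).
  apply/funext => y.
  have -> : \sum_(i <- s) cf i * atomhat H i y =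
      \sum_(j <- J) \sum_(k <- sj j) cf (j, k) * atomhat H (j, k) y.
    by apply: sum_fibers => // i _ iJ; rewrite cf0// mul0r.
  have -> : g y = \sum_(j <- J) b^-1 * (g y * (H ((c ^ j)^-1 * y) * Ht ((c ^ j)^-1 * y))).
    rewrite -!mulr_sumr; case: (eqVneq (g y) 0) => [->|gy]; first by rewrite mul0r mulr0.
    by rewrite JS ?gsupp//; field; rewrite gt_eqF.
  rewrite -sumrB; apply: eq_bigr => j _; rewrite /z mulrBr; congr (_ - _); first by ring.
  by rewrite mulr_sumr; apply: eq_bigr => k _; rewrite /atomhat /=; ring.
have bz j : BM (z j).
  rewrite /z; under [X in BM X]funext do rewrite -mulN1r.
  apply: BMD.
    by apply: BMZ; apply: BMM; [case: bg|apply: BM_mul; case: bHt].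
  apply: BMZ; elim: (sj j) => [|k t ih].
    by under [X in BM X]funext do rewrite big_nil; exact: BM_cst.
  under [X in BM X]funext do rewrite big_cons.
  by apply: BMD => //; apply: BMZ; exact: BM_cas_mul.
apply: le_lt_trans (freq_bound c0 W0 aH uJ bz) _.
have zj j : j \in J -> nrm (fun y => I y * z j (c ^ j * y)) <= b^-1 ^+ 2 * (eps / (K + 1)).
  move=> jJ.
  have -> : (fun y => I y * z j (c ^ j * y)) =
      (fun y => b^-1 * (G j y - projtri b (sj j) (G j) y)).
    apply/funext => y; rewrite /z mulKf// mulrBr [RHS]mulrBr; congr (_ - _).
      case: (ltP `|y| (hper b)) => h; first by rewrite Iper_in// mul1r.
      by rewrite G0// Iper_out// mul0r mulr0.
    rewrite /projtri !mulr_sumr; apply: eq_bigr => k _.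
    by rewrite -mulrA mulrA cfE /tri; field; rewrite gt_eqF.
  rewrite nrmZ; last by apply: SQB; [exact: BC_SQ|exact: SQ_projtri].
  rewrite ler_wpM2l ?sqr_ge0// nrm_projtri//; last exact: BC_SQ.
  by apply/ltW/SP => //; exact: Ssj.
apply: le_lt_trans (_ : W * M * \sum_(j <- J) c ^ j * (b^-1 ^+ 2 * (eps / (K + 1))) < _).
  rewrite ler_wpM2l ?mulr_ge0// big_seq [leRHS]big_seq ler_sum// => j jJ.
  by rewrite ler_wpM2l ?zj// ltW// cexp_gt0.
rewrite -mulr_suml.
have -> : W * M * ((\sum_(j <- J) c ^ j) * (b^-1 ^+ 2 * (eps / (K + 1)))) = K * (eps / (K + 1)).
  by move: (eps / (K + 1)) => e'; rewrite /K; field; rewrite gt_eqF.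
have K1 : 0 < K + 1 by rewrite ltr_wpDl.
rewrite mulrA (mulrC K) -mulrA gtr_pMr// ltr_pdivrMr// mul1r ltrDl.
exact: ltr01.
Qed.

End WaveletFrames.

(** * The functions [h_n]: support, positivity and sums over dilates *)

Section IteratedKernels.
Variables (R : realType) (c : R).
Local Notation mu := (@lebesgue_measure R).

(** A division-free form of [chiS c (g / |t|)]. The two agree also at [t = 0]: the quotient is then
    [0], which lies outside [S], and the two inequalities here contradict each other. *)
Definition kerS (g t : R) : R := ((c * `|t| < `|g|) && (`|g| <= `|t|))%R%:R.

Lemma chiS_norm x : 0 < c -> chiS c x = ((c < `|x|) && (`|x| <= 1))%R%:R.
Proof.
move=> c0; rewrite /chiS indicE; congr (nat_of_bool _)%:R.
apply/idP/idP; rewrite inE /Sset /=.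
  move=> [[h1 h2]|[h1 h2]].
    by rewrite ltr0_norm; [apply/andP; split|]; lra.
  by rewrite gtr0_norm; [apply/andP; split|]; lra.
by case: (ger0P x) => x0 /andP[h1 h2]; [right|left]; split; lra.
Qed.

Lemma chiS_div g t : 0 < c -> chiS c (g / `|t|) = kerS g t.
Proof.
move=> c0; rewrite chiS_norm// /kerS; congr (nat_of_bool _)%:R.
case: (eqVneq t 0) => [->|t0].
  rewrite !normr0 invr0 mulr0 normr0 mulr0 (ltNge c) (ltW c0) /=.
  by case: ltP => // h; rewrite leNgt h.
by rewrite normrM normfV normr_id ltr_pdivlMr ?normr_gt0// ler_pdivrMr ?normr_gt0// mul1r.
Qed.

Lemma kerS_ge0 g t : 0 <= kerS g t. Proof. by []. Qed.

Lemma kerS_le1 g t : kerS g t <= 1.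
Proof. by rewrite /kerS; case: (_ && _). Qed.

(** Written through the step function, joint measurability in [g] and [t] follows by composition. *)
Lemma kerS_stp g t : kerS g t = stp 0 (`|t| - `|g|) * (1 - stp 0 (c * `|t| - `|g|)).
Proof.
rewrite /kerS /stp !subr_ge0 ltNge andbC.
by case: (`|g| <= `|t|); case: (`|g| <= c * _);
  rewrite /= ?(mulr1n, mulr0n, mul0r, mulr0, subr0, subrr, mulr1).
Qed.

Lemma BM_kerS g : BM (kerS g).
Proof.
split; last by exists 1 => t; rewrite ger0_norm ?kerS_ge0// kerS_le1.
have -> : kerS g = (fun t => stp 0 (`|t| - `|g|) * (1 - stp 0 (c * `|t| - `|g|))).
  by apply/funext => t; exact: kerS_stp.
have ms := (@BM_stp R 0).1.
apply: measurable_funM.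
  by apply: measurableT_comp => //; apply: measurable_funB => //; exact: measurableT_comp.
apply: measurable_funB => //; apply: measurableT_comp => //; apply: measurable_funB => //.
by apply: measurable_funM => //; exact: measurableT_comp.
Qed.

Lemma measurable_kerS_prod : measurable_fun [set: R * R] (fun z : R * R => kerS z.1 z.2).
Proof.
have -> : (fun z : R * R => kerS z.1 z.2) =
    (fun z => stp 0 (`|z.2| - `|z.1|) * (1 - stp 0 (c * `|z.2| - `|z.1|))).
  by apply/funext => z; exact: kerS_stp.
have ms := (@BM_stp R 0).1.
have m1 : measurable_fun [set: R * R] (fun z : R * R => `|z.1|).
  by apply: measurableT_comp => //; exact: measurable_fst.
have m2 : measurable_fun [set: R * R] (fun z : R * R => `|z.2|).
  by apply: measurableT_comp => //; exact: measurable_snd.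
apply: measurable_funM.
  by apply: measurableT_comp => //; exact: measurable_funB.
apply: measurable_funB => //; apply: measurableT_comp => //; apply: measurable_funB => //.
exact: measurable_funM.
Qed.

Lemma hpreS m g : 0 < c -> hpre c m.+1 g = Rint (fun t => hpre c m t * kerS g t).
Proof. by move=> c0 /=; apply: Rint_ext => t; rewrite chiS_div. Qed.

Lemma hpre_ge0 m g : 0 < c -> 0 <= hpre c m g.
Proof.
move=> c0; elim: m g => [|m ih] g; first by rewrite /= chiS_norm.
by rewrite hpreS//; apply: Rint_ge0 => t; rewrite mulr_ge0.
Qed.

Lemma hpre_even m g : 0 < c -> hpre c m (- g) = hpre c m g.
Proof.
move=> c0; case: m => [|m]; first by rewrite /= !chiS_norm// normrN.
by rewrite !hpreS//; apply: Rint_ext => t; rewrite /kerS normrN.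
Qed.

(** A nonzero integrand has [c * |t| < |g| <= |t|], so each iteration shrinks the inner radius by
    [c] and keeps the outer one. *)
Lemma hpre_supp m g : 0 < c -> hpre c m g != 0 -> c ^+ m.+1 < `|g| <= 1.
Proof.
move=> c0; elim: m g => [|m ih] g.
  by rewrite /= chiS_norm// expr1; case: (_ && _); rewrite ?eqxx.
apply: contraNT => hg; rewrite hpreS// -(Rint_cst0 R); apply/eqP; apply: Rint_ext => t.
case: (eqVneq (hpre c m t) 0) => [->|/ih /andP[h1 h2]]; first by rewrite mul0r.
rewrite /kerS; case: andP => [[h3 h4]|_]; last by rewrite mulr0.
exfalso; move/negP: hg; apply; apply/andP; split; last exact: le_trans h2.
by apply: le_lt_trans h3; rewrite exprS ler_wpM2l// ltW.
Qed.

Lemma BC_hpre m : 0 < c -> BC (hpre c m).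
Proof.
move=> c0; elim: m => [|m bm].
  split; last first.
    exists 1 => x hx; apply/eqP; apply: contraTT hx => /(hpre_supp c0) /andP[_].
    by rewrite leNgt.
  apply: BM_indic; apply: measurableU.
    have -> : [set x | -1 <= x /\ x < - c] = `[-1, - c[%classic.
      by apply/seteqP; split => x /=; rewrite in_itv/=; [move=> [-> ->]|move=> /andP[]].
    exact: measurable_itv.
  have -> : [set x | c < x /\ x <= 1] = `]c, 1]%classic.
    by apply/seteqP; split => x /=; rewrite in_itv/=; [move=> [-> ->]|move=> /andP[]].
  exact: measurable_itv.
split; last first.
  exists 1 => x hx; apply/eqP; apply: contraTT hx => /(hpre_supp c0) /andP[_].
  by rewrite leNgt.
have bk g : integ (fun t => hpre c m t * kerS g t).
  by apply/BC_integ/BCM => //; exact: BM_kerS.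
split; last first.
  exists (Rint (hpre c m)) => g; rewrite ger0_norm ?hpre_ge0// hpreS//.
  apply: Rint_le => //; first exact: BC_integ.
  by move=> t; rewrite ler_piMr ?hpre_ge0// kerS_le1.
have [[mm _] _] := bm.
pose F (z : R * R) := (hpre c m z.2 * kerS z.1 z.2)%:E.
have mF : measurable_fun [set: R * R] F.
  apply/measurable_EFinP; apply: measurable_funM; last exact: measurable_kerS_prod.
  exact: measurableT_comp.
have F0 z : (0 <= F z)%E by rewrite lee_fin mulr_ge0// hpre_ge0.
have mFF := @measurable_fun_fubini_tonelli_F _ _ (measurableTypeR R) (measurableTypeR R) R mu F mF F0.
have -> : hpre c m.+1 = fun x => fine (fubini_F mu F x).
  by apply/funext => x; rewrite hpreS.
by apply: measurableT_comp => //; exact: measurable_fine.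
Qed.

Lemma integ_hpre_ker m g : 0 < c -> integ (fun t => hpre c m t * kerS g t).
Proof. by move=> c0; apply/BC_integ/BCM; [exact: BC_hpre|exact: BM_kerS]. Qed.

(* For [|g| = 1] the integrand lives on the null set [{1, -1}]; this is what
   allows the extreme case [b = c ^+ n.-1 / 2]. *)
Lemma hpreS_out m g : 0 < c -> 1 <= `|g| -> hpre c m.+1 g = 0.
Proof.
move=> c0 g1; rewrite hpreS//; have bi := integ_hpre_ker m g c0.
have h0 t : t != 1 -> t != -1 -> hpre c m t * kerS g t = 0.
  move=> t1 t2; case: (eqVneq (hpre c m t) 0) => [->|/(hpre_supp c0) /andP[_ h]].
    by rewrite mul0r.
  rewrite /kerS; case: andP => [[_ h4]|_]; last by rewrite mulr0.
  have : `|t| = 1 by apply/eqP; rewrite eq_le h (le_trans g1 h4).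
  by move/eqP; rewrite eqr_norml (negPf t1) (negPf t2).
have bA (a : R) : integ (fun t => \1_[set a] t * (hpre c m t * kerS g t)).
  apply: BC_integ; apply: BMMC; first exact: BM_indic.
  by apply: BCM; [exact: BC_hpre|exact: BM_kerS].
rewrite (@Rint_ext _ _ (fun t => \1_[set 1] t * (hpre c m t * kerS g t) +
   \1_[set (-1)] t * (hpre c m t * kerS g t))) => [|t].
  by rewrite RintD// !Rint_indicM !Rintegral_set1 addr0.
have E (a : R) : \1_[set a] t = (t == a)%R%:R :> R.
  by rewrite indicE; congr (nat_of_bool _)%:R; apply/idP/eqP; rewrite inE.
rewrite !E.
have N11 : (1 : R) != -1 by rewrite -subr_eq0 opprK gt_eqF.
case: (eqVneq t 1) => [->|t1]; first by rewrite (negPf N11) mul1r mul0r addr0.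
case: (eqVneq t (-1)) => [->|t2]; first by rewrite mul0r mul1r add0r.
by rewrite h0// !mulr0 addr0.
Qed.

(** Serves the positivity of [Q]. The invariant [c * be < al] leaves room for the next interval. *)
Lemma hpre_interval m : 0 < c < 1 -> exists al be e : R,
  [/\ 0 < al, al < be, c * be < al, 0 < e & forall t, al <= t < be -> e <= hpre c m t].
Proof.
move=> /andP[c0 c1]; elim: m => [|m [al [be [e [a0 ab cb e0 he]]]]].
  exists ((1 + c) / 2), 1, 1; split; rewrite ?mulr1; [lra..|].
  move=> t /andP[h1 h2]; rewrite /= chiS_norm// gtr0_norm; last lra.
  have -> : c < t by lra.
  by rewrite (ltW h2).
(* For [t] in [[al, be[] and [g] in the new interval, [c * t < c * be < g < al <= t], so the kernel
   equals [1] and the integral is at least [e * (be - al)]. *)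
exists ((c * be + al) / 2), al, (e * (be - al)).
have cb0 : 0 < c * be by rewrite mulr_gt0//; lra.
split; [lra|lra| |by rewrite mulr_gt0// subr_gt0|].
  have : c * al < c * be by rewrite ltr_pM2l.
  lra.
move=> g /andP[h1 h2]; rewrite hpreS//.
have bc := BC_cell (ltW ab).
rewrite -(Rint_cell (ltW ab)) -RintZ; last exact: BC_integ.
apply: Rint_le; [exact/integZ/BC_integ|exact: integ_hpre_ker|].
move=> t; rewrite (cellE _ (ltW ab)); case: (boolP (al <= t < be)) => h; last first.
  by rewrite mulr0 mulr_ge0// hpre_ge0.
have /andP[h3 h4] := h.
have h5 : c * t < c * be by rewrite ltr_pM2l.
have -> : kerS g t = 1.
  rewrite /kerS !gtr0_norm; [|lra..].
  have -> : c * t < g by lra.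
  by have -> : g <= t by lra.
by rewrite !mulr1 he.
Qed.

Lemma Rint_hpre_gt0 m : 0 < c < 1 -> 0 < Rint (hpre c m).
Proof.
move=> c01; have [al [be [e [a0 ab cb e0 he]]]] := hpre_interval m c01.
have /andP[c0 _] := c01.
have bc := BC_cell (ltW ab).
apply: (@lt_le_trans _ _ (e * (be - al))); first by rewrite mulr_gt0// subr_gt0.
rewrite -(Rint_cell (ltW ab)) -RintZ; last exact: BC_integ.
apply: Rint_le; [exact/integZ/BC_integ|exact/BC_integ/BC_hpre|].
move=> t; rewrite (cellE _ (ltW ab)); case: (boolP (al <= t < be)) => h.
  by rewrite mulr1 he.
by rewrite mulr0 hpre_ge0.
Qed.

Lemma expr_small e : 0 < c < 1 -> 0 < e -> exists N, forall n, (N <= n)%N -> c ^+ n < e.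
Proof.
move=> /andP[c0 c1] e0.
have h : c ^+ n @[n --> \oo] --> (0 : R) by apply: cvg_expr; rewrite gtr0_norm.
have [N NP] := cvg_to0P h e0.
by exists N => n /NP; rewrite ger0_norm// exprn_ge0// ltW.
Qed.

Lemma exists_scale x : 0 < c < 1 -> 0 < x -> exists j : int, c < (c ^ j)^-1 * x <= 1.
Proof.
move=> c01 x0; have /andP[c0 c1] := c01.
have [M MP] := expr_small c01 x0.
have wM := MP M (leqnn M).
have cM0 : 0 < c ^+ M by rewrite exprn_gt0.
(* [x] is first blown up beyond [1]; the least [n] with [c ^+ n * w <= 1] is then positive, and
   failure at [n.-1] gives the lower bound [c]. *)
pose w := (c ^+ M)^-1 * x.
have w1 : 1 < w by rewrite /w mulrC ltr_pdivlMr// mul1r.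
have w0 : 0 < w by lra.
have wi : 0 < w^-1 by rewrite invr_gt0.
have [N NP] := expr_small c01 wi.
have exn : exists n, c ^+ n * w <= 1.
  by exists N; rewrite -ler_pdivlMr// mul1r; exact/ltW/NP.
case: (ex_minnP exn) => n hn nmin.
have n0 : (0 < n)%N by case: n hn nmin => // ; rewrite expr0 mul1r => h; lra.
have E k : (c ^ (M%:Z - k%:Z))^-1 * x = c ^+ k * w.
  rewrite expfzDr ?gt_eqF// -invr_expz -!exprnP /w; field.
  by rewrite !expf_neq0 ?gt_eqF.
exists (M%:Z - n%:Z); rewrite E hn andbT.
have : ~~ (c ^+ n.-1 * w <= 1).
  by apply/negP => /nmin; rewrite leqNgt ltn_predL n0.
by rewrite -ltNge -(ltr_pM2l c0) mulr1 mulrA -exprS prednK.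
Qed.

Lemma scale_unique x (i j : int) : 0 < c < 1 -> 0 < x ->
  c < (c ^ i)^-1 * x <= 1 -> c < (c ^ j)^-1 * x <= 1 -> i = j.
Proof.
move=> /andP[c0 c1] x0.
wlog ij : i j / i <= j => [wl h1 h2|].
  by case/orP: (le_total i j) => h; [exact: wl|apply/esym/wl].
move=> /andP[h1 h2] /andP[h3 h4].
apply/eqP; rewrite eq_le ij /= leNgt; apply/negP => ltij.
have : (c ^ i)^-1 * x = c ^ (j - i) * ((c ^ j)^-1 * x).
  rewrite expfzDr ?gt_eqF// -invr_expz; field.
  by rewrite !expfz_neq0 ?gt_eqF.
move=> E; have : (c ^ i)^-1 * x <= c.
  rewrite E.
  have -> : j - i = `|j - i|%N by rewrite gez0_abs// subr_ge0.
  have : (0 < `|j - i|)%N by rewrite absz_gt0 subr_eq0 gt_eqF.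
  case: `|j - i|%N => // k _.
  rewrite -exprnP exprS -mulrA -[leRHS]mulr1 ler_pM2l//.
  by rewrite mulr_ile1 ?exprn_ge0 ?exprn_ile1 ?(ltW c0) ?(ltW c1)//; lra.
lra.
Qed.

(** Only the ratio [|y| / |t|] matters, so for fixed [t] the contributing scales are governed by
    [exists_scale] and [scale_unique]. *)
Lemma kerS_scale y t j : 0 < c -> t != 0 ->
  kerS ((c ^ j)^-1 * y) t = (c < (c ^ j)^-1 * (`|y| / `|t|) <= 1)%R%:R.
Proof.
move=> c0 t0; rewrite /kerS normrM normfV (gtr0_norm (exprz_gt0 j c0)).
by rewrite mulrA ltr_pdivlMr ?normr_gt0// ler_pdivrMr ?normr_gt0// mul1r.
Qed.

Lemma kerS_sum_le1 (J : seq int) y t : 0 < c < 1 -> uniq J ->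
  \sum_(j <- J) kerS ((c ^ j)^-1 * y) t <= 1.
Proof.
move=> c01 uJ; have /andP[c0 c1] := c01.
case: (boolP (has (fun j => kerS ((c ^ j)^-1 * y) t != 0) J)) => [/hasP[j jJ hj]|/hasPn h].
  rewrite (bigD1_seq j)//= big1_seq ?addr0 ?kerS_le1// => i /andP[ij iJ].
  apply/eqP; apply: contraNT ij => hi.
  have t0 : t != 0.
    apply: contraNN hj => /eqP ->; rewrite /kerS normr0 mulr0.
    by case: ltP => // h; rewrite leNgt h.
  have y0 : 0 < `|y|.
    rewrite normr_gt0; apply: contraNN hj => /eqP ->.
    by rewrite /kerS mulr0 normr0 ltNge mulr_ge0// ltW.
  apply/eqP; apply: (@scale_unique (`|y| / `|t|)) => //.
  - by rewrite divr_gt0// normr_gt0.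
  - by move: hi; rewrite kerS_scale//; case: (_ < _ <= _); rewrite ?eqxx.
  - by move: hj; rewrite kerS_scale//; case: (_ < _ <= _); rewrite ?eqxx.
by rewrite big1_seq// => i /andP[_ /h]; rewrite negbK => /eqP.
Qed.

Lemma hpreS_sum m (J : seq int) y : 0 < c ->
  \sum_(j <- J) hpre c m.+1 ((c ^ j)^-1 * y) =
  Rint (fun t => hpre c m t * \sum_(j <- J) kerS ((c ^ j)^-1 * y) t).
Proof.
move=> c0; under eq_bigr do rewrite hpreS//.
rewrite -Rint_sum; last by move=> j; exact: integ_hpre_ker.
by apply: Rint_ext => t; rewrite mulr_sumr.
Qed.

Lemma integ_hpre_sum m (J : seq int) y : 0 < c ->
  integ (fun t => hpre c m t * \sum_(j <- J) kerS ((c ^ j)^-1 * y) t).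
Proof.
move=> c0; under [X in integ X]funext do rewrite mulr_sumr.
by apply: integ_sum => j; exact: integ_hpre_ker.
Qed.

(** Supplies the constant [W] of [admissible] for [h_n], namely [Q_(n-1)]. *)
Lemma hpreS_sum_le m (J : seq int) y : 0 < c < 1 -> uniq J ->
  \sum_(j <- J) hpre c m.+1 ((c ^ j)^-1 * y) <= Rint (hpre c m).
Proof.
move=> c01 uJ; have /andP[c0 _] := c01; rewrite hpreS_sum//.
apply: Rint_le; [exact: integ_hpre_sum|exact/BC_integ/BC_hpre|].
by move=> t; rewrite ler_piMr ?hpre_ge0// kerS_sum_le1.
Qed.

(* The dilates of [S] by powers of [c] tile the punctured line. *)
Lemma hpreS_sum_eq m (J : seq int) y : 0 < c < 1 -> uniq J -> y != 0 ->
  (forall j, c ^+ m.+2 < (c ^ j)^-1 * `|y| <= 1 -> j \in J) ->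
  \sum_(j <- J) hpre c m.+1 ((c ^ j)^-1 * y) = Rint (hpre c m).
Proof.
move=> c01 uJ y0 hJ; have /andP[c0 c1] := c01; rewrite hpreS_sum//.
apply: Rint_ext => t.
case: (eqVneq (hpre c m t) 0) => [->|]; first by rewrite mul0r.
move=> /(hpre_supp c0) /andP[h1 h2].
have t0 : t != 0 by rewrite -normr_gt0; apply: le_lt_trans h1; rewrite exprn_ge0// ltW.
have tp : 0 < `|t| by rewrite normr_gt0.
suff -> : \sum_(j <- J) kerS ((c ^ j)^-1 * y) t = 1 by rewrite mulr1.
apply/eqP; rewrite eq_le kerS_sum_le1//=.
have yp : 0 < `|y| by rewrite normr_gt0.
have [j hj] := exists_scale c01 (divr_gt0 yp tp).
have jJ : j \in J.
  apply: hJ; move: hj; rewrite mulrA ltr_pdivlMr// ler_pdivrMr// mul1r => /andP[h3 h4].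
  apply/andP; split; last exact: le_trans h2.
  by apply: le_lt_trans h3; rewrite exprS ler_wpM2l// ltW.
rewrite (bigD1_seq j)//= kerS_scale// hj lerDl.
by apply: sumr_ge0.
Qed.

End IteratedKernels.

(** * The generator and its dual: admissibility and the partition identity, with [n = m + 2] *)

Section Generators.
Variables (R : realType) (c b : R) (m : nat).
Local Notation q := (Rint (hpre c m)).
Local Notation H := (hpre c m.+1).
Local Notation Ht := (psit_hat c m.+2 b).

Lemma cexp_le (i j : int) : 0 < c < 1 -> i <= j -> c ^ j <= c ^ i.
Proof.
move=> /andP[c0 c1] ij.
have -> : j = i + `|j - i|%N by lia.
rewrite expfzDr ?gt_eqF// ler_piMr ?exprz_ge0 ?(ltW c0)//.
by rewrite -exprnP exprn_ile1 ?ltW.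
Qed.

Lemma cexp_lt_inv (i j : int) : 0 < c < 1 -> c ^ j < c ^ i -> i < j.
Proof. by move=> c01; rewrite !ltNge; apply: contraNN => /(cexp_le c01). Qed.

Lemma exprVz k : (c ^+ k)^-1 = c ^ (- k%:Z).
Proof. by rewrite exprnP invr_expz. Qed.

(* The dilates in [psit_hat] are by [c ^ (- j)] for [j] in [window]. *)
Definition window : seq int := [seq m.+1%:Z - i%:Z | i <- index_iota 0 m.+1.*2.+1].

Lemma window_uniq : uniq window.
Proof.
by rewrite map_inj_uniq ?iota_uniq// => i j /= h; lia.
Qed.

Lemma mem_window j : (j \in window) = (- m.+1%:Z <= j <= m.+1%:Z).
Proof.
apply/mapP/idP => [[i]|/andP[h1 h2]].
  by rewrite mem_index_iota => /andP[_ iN] ->; lia.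
exists `|(m.+1%:Z - j)%R|%N; last by lia.
by rewrite mem_index_iota; lia.
Qed.

Lemma psit_hatE g : Ht g = b / q ^+ 2 * \sum_(j <- window) H ((c ^ j)^-1 * g).
Proof.
rewrite /psit_hat /Q /h /=; congr (_ * _).
rewrite /window big_map big_mkord; apply: eq_bigr => i _.
by rewrite invr_expz opprB.
Qed.

Hypothesis c01 : 0 < c < 1.
Hypothesis b0 : 0 < b.
Hypothesis bc : b <= c ^+ m.+1 / 2.

Let c0 : 0 < c. Proof. by case/andP: c01. Qed.
Let c1 : c < 1. Proof. by case/andP: c01. Qed.
Let q0 : 0 < q. Proof. exact: Rint_hpre_gt0. Qed.

(** Here the upper bound on [b] enters: both generators vanish for [|y|] at least
    [(c ^+ m.+1)^-1]. *)
Lemma hper_ge : (c ^+ m.+1)^-1 <= hper b.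
Proof.
have := bc; have := b0 => b0' bc'.
rewrite /hper lef_pV2 ?posrE ?exprn_gt0 ?mulr_gt0//; lra.
Qed.

Lemma cVexp_ge1 k : 1 <= (c ^+ k)^-1.
Proof. by rewrite invf_ge1 ?exprn_gt0// exprn_ile1// ltW. Qed.

Lemma admissible_h : exists M, admissible c b H M q.
Proof.
have bH : BC H by exact: BC_hpre.
have [[_ [M HM]] _] := bH.
exists M; split => //.
- by move=> y; exact: hpre_even.
- move=> y; apply/andP; split; first exact: hpre_ge0.
  exact: le_trans (ler_norm _) (HM y).
- by move=> y hy; apply: hpreS_out => //; apply: le_trans hy; exact: le_trans (cVexp_ge1 _) hper_ge.
- by move=> J y uJ; exact: hpreS_sum_le.
Qed.

Lemma admissible_psit_hat : exists M W, admissible c b Ht M W.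
Proof.
have bq : 0 <= b / q ^+ 2 by rewrite divr_ge0 ?exprn_ge0 ?(ltW b0) ?(ltW q0).
have -> : Ht = fun g => b / q ^+ 2 * \sum_(j <- window) H ((c ^ j)^-1 * g).
  by apply/funext => g; exact: psit_hatE.
(* The window exponents are distinct, so their sum is at most [q]. For the second constant the sums
   over [J] and over the window are exchanged, and each window term contributes at most [q]. *)
exists (b / q ^+ 2 * q), (b / q ^+ 2 * \sum_(j <- window) q); split.
- apply: BCZ; apply: BC_sum => j; apply: BC_dil; last exact: BC_hpre.
  by rewrite invr_eq0 gt_eqF// exprz_gt0.
- by move=> y; congr (_ * _); apply: eq_bigr => j _; rewrite mulrN hpre_even.
- move=> y; apply/andP; split.
    by apply: mulr_ge0 => //; apply: sumr_ge0 => j _; exact: hpre_ge0.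
  by rewrite ler_wpM2l// hpreS_sum_le// window_uniq.
- move=> y hy; rewrite big1_seq ?mulr0// => j /andP[_]; rewrite mem_window => /andP[h1 _].
  apply: hpreS_out => //.
  rewrite normrM normfV (gtr0_norm (exprz_gt0 j c0)).
  rewrite mulrC ler_pdivlMr ?exprz_gt0// mul1r; apply: le_trans hy; apply: le_trans hper_ge.
  by rewrite exprVz; exact: cexp_le.
- move=> J y uJ; rewrite -mulr_sumr ler_wpM2l// exchange_big /=.
  apply: ler_sum => i _; under eq_bigr do rewrite mulrCA.
  exact: hpreS_sum_le.
Qed.

(** The thresholds are those of [Ht_zero]: the window dilates [h_n], supported in
    [c ^+ m.+2 < |w| <= 1], by factors between [c ^+ m.+1] and its inverse. *)
Lemma window_escape d L : 0 < d -> exists N0, forall j y, j \notin zrange N0 ->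
  d <= `|y| <= L ->
  (c ^+ m.+1)^-1 < `|(c ^ j)^-1 * y| \/ `|(c ^ j)^-1 * y| < c ^+ (m.+1 + m.+2).
Proof.
move=> d0.
have L0 : 0 < `|L| + 1 by rewrite ltr_wpDl.
have e1 : 0 < c ^+ m.+1 * d by rewrite mulr_gt0// exprn_gt0.
have e2 : 0 < c ^+ (m.+1 + m.+2) / (`|L| + 1) by rewrite divr_gt0// exprn_gt0.
have [N1 P1] := expr_small c01 e1; have [N2 P2] := expr_small c01 e2.
pose N0 := maxn N1 N2.
have {}P1 := P1 _ (leq_maxl N1 N2); have {}P2 := P2 _ (leq_maxr N1 N2).
exists N0 => j y; rewrite mem_zrange negb_and -!ltNge -leNgt => /orP[jN|jN] /andP[dy yL].
  right; rewrite normrM normfV (gtr0_norm (exprz_gt0 j c0)).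
  have h : (c ^ j)^-1 <= c ^+ N0 by rewrite invr_expz exprnP; apply: cexp_le; rewrite // lerNr ltW.
  apply: (@le_lt_trans _ _ (c ^+ N0 * (`|L| + 1))).
    apply: ler_pM => //; first by rewrite invr_ge0 exprz_ge0// ltW.
    by have := ler_norm L; lra.
  by rewrite -ltr_pdivlMr.
left; rewrite normrM normfV (gtr0_norm (exprz_gt0 j c0)).
have h : c ^ j <= c ^+ N0 by rewrite exprnP; exact: cexp_le.
rewrite mulrC ltr_pdivlMr ?exprz_gt0// mulrC ltr_pdivrMr ?exprn_gt0//.
apply: le_lt_trans h _; apply: lt_le_trans P1 _.
by rewrite mulrC ler_wpM2r// exprn_ge0// ltW.
Qed.

Lemma Ht_zero w : (c ^+ m.+1)^-1 < `|w| \/ `|w| < c ^+ (m.+1 + m.+2) -> Ht w = 0.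
Proof.
move=> hw; rewrite psit_hatE big1_seq ?mulr0// => i /andP[_].
rewrite mem_window => /andP[i1 i2].
have ci := exprz_gt0 i c0.
case: hw => hw.
  apply: hpreS_out => //; rewrite normrM normfV (gtr0_norm ci).
  rewrite mulrC ler_pdivlMr// mul1r; apply: le_trans (ltW hw).
  by rewrite exprVz; exact: cexp_le.
apply/eqP; apply: contraT => /(hpre_supp c0) /andP[h1 _].
move: h1; rewrite normrM normfV (gtr0_norm ci) mulrC ltr_pdivlMr// => h1.
have : c ^+ (m.+1 + m.+2) <= c ^+ m.+2 * c ^ i.
  rewrite !exprnP -expfzDr ?gt_eqF//; apply: cexp_le => //.
  by rewrite addnC PoszD lerD2l.
by move=> h; have := lt_trans hw (le_lt_trans h h1); rewrite ltxx.
Qed.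

(** On the support of [H] the dual generator is the constant [b / q]. If [w] and [(c ^ j)^-1 * w]
    both have modulus in []c ^+ m.+2, 1]], then [c ^ j] and its inverse exceed [c ^+ m.+2], so
    [|j| <= m.+1]: the window misses no scale and its sum is the full [q]. *)
Lemma HHt w : H w * Ht w = b / q * H w.
Proof.
case: (eqVneq (H w) 0) => [->|hw]; first by rewrite mul0r mulr0.
have /andP[h1 h2] := hpre_supp c0 hw.
have w0 : w != 0.
  by rewrite -normr_gt0; apply: le_lt_trans h1; rewrite exprn_ge0// ltW.
rewrite psit_hatE (@hpreS_sum_eq _ _ _ _ w)//; last first.
- move=> j /andP[h3 h4]; rewrite mem_window.
  have cj := exprz_gt0 j c0.
  rewrite mulrC ler_pdivrMr// mul1r in h4.
  have : c ^ m.+2%:Z < c ^ j by rewrite -exprnP; exact: lt_le_trans h1 h4.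
  move/(cexp_lt_inv c01) => h5.
  have : c ^ m.+2%:Z < c ^ (- j).
    rewrite -invr_expz -exprnP; apply: lt_le_trans h3 _.
    by rewrite ler_piMr// invr_ge0 ltW.
  by move/(cexp_lt_inv c01) => h6; clear - h5 h6; lia.
- exact: window_uniq.
by have := q0 => q0'; field; rewrite gt_eqF.
Qed.

(** By [HHt] the sum is [b / q] times a sum of dilates of [h_n], which equals [q]; the escape
    thresholds exclude scales outside the range for [h_n] as well as for [Ht]. *)
Lemma calderon d L : 0 < d -> exists J : seq int, uniq J /\
  (forall j y, j \notin J -> d <= `|y| <= L -> Ht ((c ^ j)^-1 * y) = 0) /\
  (forall y, d <= `|y| <= L ->
     \sum_(j <- J) H ((c ^ j)^-1 * y) * Ht ((c ^ j)^-1 * y) = b).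
Proof.
move=> d0; have [N0 P] := window_escape L d0.
exists (zrange N0); split; first exact: zrange_uniq.
split => [j y hj hy|y hy]; first by apply: Ht_zero; exact: P.
have /andP[dy _] := hy.
have y0 : y != 0 by rewrite -normr_gt0; exact: lt_le_trans dy.
under eq_bigr do rewrite HHt.
rewrite -mulr_sumr (@hpreS_sum_eq _ _ _ _ y)//.
- by rewrite divfK// gt_eqF.
- exact: zrange_uniq.
move=> j /andP[h1 h2]; apply/negPn/negP => hj.
have := P j y hj hy; rewrite normrM normfV (gtr0_norm (exprz_gt0 j c0)) => -[h|h].
  by have := lt_le_trans h h2; rewrite ltNge cVexp_ge1.
have : c ^+ (m.+1 + m.+2) <= c ^+ m.+2.
  by rewrite !exprnP; apply: cexp_le; rewrite // lez_nat leq_addl.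
by move=> h3; have := lt_trans h (le_lt_trans h3 h1); rewrite ltxx.
Qed.

End Generators.

(** * From real to complex-valued functions *)

Section RealSystems.
Variable R : realType.

(** Evenness kills the imaginary part and lets the odd sine term be added to the real part, turning
    [cos] into [cas]. *)
Lemma invFT_even (G : R -> R) : BC G -> (forall y, G (- y) = G y) ->
  invFT G = (Hart G, fun=> 0).
Proof.
move=> bG ev; congr (_, _); apply/funext => x.
  have ic : integ (fun y => G y * cos (2 * pi * x * y)).
    by apply/BC_integ/BCM => //; exact: BM_cos_lin.
  have is_ : integ (fun y => G y * sin (2 * pi * x * y)).
    by apply/BC_integ/BCM => //; exact: BM_sin_lin.
  apply/esym; apply: (Rint_eqmod is_ _ ic) => y; last by rewrite /cas mulrDr.
  by rewrite ev mulrN sinN mulrN.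
apply: Rint_odd; first by apply/BC_integ/BCM => //; exact: BM_sin_lin.
by move=> y; rewrite ev mulrN sinN mulrN.
Qed.

Lemma wsys_atom (c b : R) (G : R -> R) : 0 < c -> BC G -> (forall y, G (- y) = G y) ->
  wsys c b (invFT G) = fun i => (atom c b G i, fun=> 0).
Proof.
move=> c0 bG ev; apply/funext => i; rewrite invFT_even// /wsys /Dil /Tr /=.
congr (_, _); apply/funext => x; rewrite (gtr0_norm (exprz_gt0 _ c0))//.
by rewrite mulr0.
Qed.

Lemma L2_real (r : R -> R) : SQ r -> L2 (r, fun=> 0).
Proof.
move=> [mr r2]; split => //; split => //=.
by under [X in _.-integrable _ X]funext do rewrite expr0n addr0.
Qed.

Lemma L2_SQ (f : cfun R) : L2 f -> SQ f.1 /\ SQ f.2.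
Proof.
move=> [m1 [m2 fi]]; split; split => //; apply: integ_le fi.
- by apply: measurable_funX.
- by move=> x; rewrite ger0_norm ?sqr_ge0// lerDl sqr_ge0.
- by apply: measurable_funX.
- by move=> x; rewrite ger0_norm ?sqr_ge0// lerDr sqr_ge0.
Qed.

Lemma norm2sqE (f : cfun R) : SQ f.1 -> SQ f.2 -> norm2sq f = nrm f.1 + nrm f.2.
Proof. by move=> [_ s1] [_ s2]; rewrite /norm2sq RintD. Qed.

Lemma inner_real (f : cfun R) r : inner f (r, fun=> 0) = (ip f.1 r, ip f.2 r).
Proof. by congr (_, _); apply: Rint_ext => x /=; rewrite mulr0 ?addr0 ?subr0. Qed.

Lemma bessel_real (I : choiceType) (e : I -> R -> R) B : 0 <= B ->
  synthesis_bound e B -> Bessel (fun i => (e i, fun=> 0)).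
Proof.
move=> B0 He; have [se _] := He; split => [i|]; first exact: L2_real.
(* [B] may be [0], whereas [Bessel] asks for a positive constant. *)
exists (B + 1); split=> [|f fL]; first by rewrite ltr_wpDl.
have [s1 s2] := L2_SQ fL.
(* The sum over all indices is a supremum over finite sets, so the finite Bessel inequality for each
   of the two parts suffices. *)
apply: ub_ereal_sup => _ [A [fA _] <-].
rewrite fsbig_finite//= sumEFin lee_fin norm2sqE//.
under eq_bigr do rewrite inner_real /cabs2 /=.
rewrite big_split /= mulrDr; apply: lerD.
  apply: le_trans (synthesis_bessel B0 He (finmap.fset_uniq _) s1) _.
  by rewrite ler_wpM2r ?nrm_ge0// lerDl.
apply: le_trans (synthesis_bessel B0 He (finmap.fset_uniq _) s2) _.
by rewrite ler_wpM2r ?nrm_ge0// lerDl.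
Qed.

Lemma reconstructs_real (I : choiceType) (e et : I -> R -> R) (f : cfun R) :
  (forall i, SQ (e i)) -> SQ f.1 -> SQ f.2 ->
  rreconstructs e et f.1 -> rreconstructs e et f.2 ->
  reconstructs (fun i => (e i, fun=> 0)) (fun i => (et i, fun=> 0)) f.
Proof.
move=> se s1 s2 h1 h2 eps e0.
(* [reconstructs] measures the norm, [rreconstructs] its square; half of [eps ^+ 2] goes to each of
   the real and imaginary parts. *)
have e2 : 0 < eps ^+ 2 / 2 by rewrite divr_gt0// exprn_gt0.
have [F1 P1] := h1 _ e2; have [F2 P2] := h2 _ e2.
exists (F1 ++ F2) => s us Fs.
have {}P1 : nrm (fun x => f.1 x - rsum e et f.1 s x) < eps ^+ 2 / 2.
  by apply: P1 => // k kF; apply: Fs; rewrite mem_cat kF.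
have {}P2 : nrm (fun x => f.2 x - rsum e et f.2 s x) < eps ^+ 2 / 2.
  by apply: P2 => // k kF; apply: Fs; rewrite mem_cat kF orbT.
have -> : csub f (psum (fun i => (e i, fun=> 0)) (fun i => (et i, fun=> 0)) f s) =
    (fun x => f.1 x - rsum e et f.1 s x, fun x => f.2 x - rsum e et f.2 s x).
  congr (_, _); apply/funext => x; congr (_ - _); apply: eq_bigr => i _.
    by rewrite inner_real /= mulr0 subr0.
  by rewrite inner_real /= mulr0 add0r.
rewrite -[ltRHS]ger0_norm ?(ltW e0)// -sqrtr_sqr ltr_sqrt ?exprn_gt0//.
have sr (g : R -> R) : SQ g -> SQ (fun x => g x - rsum e et g s x).
  by move=> sg; apply: SQB => //; exact: SQ_rsum.
by rewrite norm2sqE; [rewrite (splitr (eps ^+ 2)) ltrD|exact: sr..].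
Qed.


End RealSystems.

Theorem theorem4p3 (R : realType) (c : R) (n : nat) (b : R) :
  0 < c < 1 -> (2 <= n)%N -> 0 < b <= c ^+ n.-1 / 2 ->
  dual_frames (wsys c b (psi c n)) (wsys c b (psit c n b)).
Proof.
(* With [n = m + 2], [h c n] is [hpre c m.+1] and [Q c n.-1] is [Rint (hpre c m)]. *)
move=> c01; case: n => [//|[//|m]] _ /andP[b0 bc].
have /andP[c0 _] := c01.
have [M aH] := admissible_h c01 b0 bc.
have [Mt [Wt aHt]] := admissible_psit_hat c01 b0 bc.
have [bH evH _ _ _] := aH; have [bHt evHt _ _ _] := aHt.
rewrite /psi /psit !wsys_atom//.
have He := atom_synthesis c0 b0 aH; have Het := atom_synthesis c0 b0 aHt.
set B := Rint _ * M / b in He; set Bt := Wt * Mt / b in Het.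
have B0 : 0 <= B.
  by rewrite divr_ge0 ?(ltW b0)// mulr_ge0 ?(adm_ge0 aH) ?(adm_W_ge0 aH).
have Bt0 : 0 <= Bt.
  by rewrite divr_ge0 ?(ltW b0)// mulr_ge0 ?(adm_ge0 aHt) ?(adm_W_ge0 aHt).
split; first exact: bessel_real He.
split; first exact: bessel_real Het.
(* Vanishing of [g] near [0] bounds the active scales on one side, its bounded support on the
   other. *)
pose D (f : R -> R) := exists g, [/\ BC g, exists2 d, 0 < d & forall y, `|y| < d -> g y = 0 &
  f = Hart g].
have rec f : SQ f -> rreconstructs (atom c b (hpre c m.+1)) (atom c b (psit_hat c m.+2 b)) f.
  apply: (reconstructs_dense (D := D) B0 Bt0 He Het).
  - by move=> _ [g [bg _ ->]]; exact: SQ_Hart.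
  - move=> f' eps sf e0; have [g [bg gd gf]] := Hart_dense sf e0.
    by exists (Hart g) => //; exists g.
  - move=> _ [g [bg [d d0 gd] ->]]; have [_ [L gL]] := bg.
    apply: (atom_reconstructs c0 b0 aH aHt bg d0 gd gL).
    exact: calderon.
move=> f /L2_SQ[s1 s2].
by apply: reconstructs_real => //; [case: He|exact: rec|exact: rec].
Qed.
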